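(* Let $\gamma\in[0,1)$, let $k\ge 0$ be an integer, and suppose that $f\in\mathcal{B}(\Omega_\gamma)$ has the expansion $$f(z)=\sum_{n=k}^{\infty}a_n\left(z+\frac{\gamma}{1-\gamma}\right)^n,\qquad z\in\Omega_\gamma.$$ Then $$\sum_{n=k}^{\infty}\frac{|a_n|}{(1-\gamma)^{n}}\rho^n+\left(\frac{(1-\gamma)^k}{(1-\gamma)^k+|a_k|}+\frac{\rho}{1-\rho}\right)\sum_{n=k+1}^{\infty}\frac{|a_n|^2}{(1-\gamma)^{2n}}\rho^{2n-k}\le 1$$ for $\rho\le\rho_k$, where $\rho_k$ is the root in $(0,1)$ of the equation $$5\rho^{k+1}-2\rho^k+\rho^{k-1}+4\rho-4=0.$$ The radius $\rho_k$ is best possible.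
   Context: For $\gamma\in[0,1)$, $\Omega_\gamma=\{z\in\mathbb{C}:|z+\frac{\gamma}{1-\gamma}|<\frac{1}{1-\gamma}\}$. For a domain $\Omega\subseteq\mathbb{C}$, $\mathcal{B}(\Omega)$ is the class of analytic functions $f$ on $\Omega$ with $f(\Omega)\subseteq\overline{\mathbb{D}}$, where $\mathbb{D}$ is the open unit disk. The variable $\rho$ ranges over $(0,1)$. ''Best possible'' means that $\rho_k$ cannot be replaced by a larger number: for every $\rho\in(\rho_k,1)$ there is a function $f$ satisfying the hypotheses for which the inequality fails at $\rho$. *)

(* Defs.v *)
From Stdlib Require Import Reals ZArith.
From Coquelicot Require Import Coquelicot.

Open Scope R_scope.

Definition Omega (gamma : R) (z : C) : Prop :=
  Cmod (z + RtoC (gamma / (1 - gamma)))%C < 1 / (1 - gamma).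

(* Analytic means complex differentiable at every point of the open set [D];
   values of [f] outside [D] are irrelevant. *)
Definition analytic_on (D : C -> Prop) (f : C -> C) : Prop :=
  forall z : C, D z -> ex_derive (K := C_AbsRing) (V := C_NormedModule) f z.

Definition class_B (D : C -> Prop) (f : C -> C) : Prop :=
  analytic_on D f /\ forall z : C, D z -> Cmod (f z) <= 1.

(* Sums over n >= k are written with the shift n = k + m, m >= 0; the entries
   [a n] with n < k play no role. *)
Definition has_expansion (gamma : R) (k : nat) (a : nat -> C) (f : C -> C)
    : Prop :=
  forall z : C, Omega gamma z ->
    is_series (K := C_AbsRing) (V := C_NormedModule)
      (fun m => a (k + m)%nat * (z + RtoC (gamma / (1 - gamma))) ^ (k + m))%C
      (f z).

Definition ex_series_from (k : nat) (u : nat -> R) : Prop :=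
  ex_series (fun m => u (k + m)%nat).

Definition Series_from (k : nat) (u : nat -> R) : R :=
  Series (fun m => u (k + m)%nat).

Definition lin_term (gamma : R) (a : nat -> C) (rho : R) (n : nat) : R :=
  Cmod (a n) / (1 - gamma) ^ n * rho ^ n.

(* Only used for n >= k + 1, where the natural subtraction 2n - k is exact. *)
Definition sq_term (gamma : R) (k : nat) (a : nat -> C) (rho : R) (n : nat)
    : R :=
  Cmod (a n) ^ 2 / (1 - gamma) ^ (2 * n) * rho ^ (2 * n - k).

(* [Series] is total, hence meaningless on divergent series: convergence is
   tracked separately from the value [bohr_lhs]. *)
Definition bohr_sums_converge (gamma : R) (k : nat) (a : nat -> C) (rho : R)
    : Prop :=
  ex_series_from k (lin_term gamma a rho) /\
  ex_series_from (k + 1) (sq_term gamma k a rho).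

Definition bohr_lhs (gamma : R) (k : nat) (a : nat -> C) (rho : R) : R :=
  Series_from k (lin_term gamma a rho) +
  ((1 - gamma) ^ k / ((1 - gamma) ^ k + Cmod (a k)) + rho / (1 - rho)) *
  Series_from (k + 1) (sq_term gamma k a rho).

(* The exponent k - 1 is an integer: it equals -1 when k = 0. *)
Definition radius_root (k : nat) (rho : R) : Prop :=
  0 < rho < 1 /\
  5 * rho ^ (k + 1) - 2 * rho ^ k + powerRZ rho (Z.of_nat k - 1)
    + 4 * rho - 4 = 0.

(* Main.v *)
Require Import Defs.
From Stdlib Require Import Reals ZArith Lra Lia.
From Coquelicot Require Import Coquelicot.

(** In the coordinate [w = (1 - gamma) z + gamma] of the unit disk, the function
    is [w^k h(w)] with [h = sum c_m w^m] and [|w^k h| <= 1].  With [A = |c_0|]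
    and [t = rho/(1-rho)], the left-hand side is [rho^k] times

      [A + sum_(m>=1) |c_m| rho^m + (1/(1+A) + t) sum_(m>=1) |c_m|^2 rho^(2m)]

    and everything rests on the sharp bound [A + (1 - A^2) t] for this sum
    ([refined_bohr]).  It comes from summing Carlson's inequalities

      [|c_(2n+1)| <= 1 - sum_(i<=n) |c_i|^2]

      [|c_(2n+2)| <= 1 - sum_(i<=n) |c_i|^2 - |c_(n+1)|^2/(1+A)]

    against the powers of [rho] ([carlson_odd], [carlson_even]).

    Carlson's inequalities express that multiplication by [h] does not increase
    the square norm of coefficients ([conv_norm_le]): they follow by testing
    this on one well-chosen polynomial [1 + w^s V(w)].  The contraction property
    itself is Parseval's identity.  To stay with finite sums, the mean over the
    circle is taken over roots of unity, for partial sums of the series, at a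
    radius [r < 1] that then tends to 1.

    It remains to maximize [rho^k (A + (1 - A^2) t)] over [0 <= A <= 1].  For
    [t <= 1/2] the maximum is [rho^k].  For [t >= 1/2] it is
    [rho^k (t + 1/(4t))], attained at [A = 1/(2t)]; it increases with [rho], and
    it equals 1 exactly at the root of the radius equation.  Since equality
    holds in [refined_bohr] for the disk automorphism
    [(al - w)/(1 - al w)], the function [w^k (al - w)/(1 - al w)] with
    [al = 1/(2t)] shows that the radius cannot be enlarged. *)

Open Scope R_scope.

(** * Finite sums *)

(** Terms of [sum_n] live in a carrier projected from an algebraic structure;
    [ring] recognizes the field only after the equation is retyped over [C]. *)
Ltac cring :=
  match goal with |- @eq _ ?x ?y => change (@eq C x y) end; ring.

Lemma sum_n_S_l {G : AbelianMonoid} (u : nat -> G) (n : nat) :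
  sum_n u (S n) = plus (u 0%nat) (sum_n (fun i => u (S i)) n).
Proof.
  unfold sum_n. rewrite sum_Sn_m by lia. now rewrite sum_n_m_S.
Qed.

Lemma Csum_mult_l (x : C) (u : nat -> C) (n : nat) :
  sum_n (fun i => x * u i)%C n = (x * sum_n u n)%C.
Proof. exact (sum_n_mult_l (K := C_Ring) x u n). Qed.

Lemma Rsum_mult_l (x : R) (u : nat -> R) (n : nat) :
  sum_n (fun i => x * u i) n = x * sum_n u n.
Proof. exact (sum_n_mult_l (K := R_Ring) x u n). Qed.

Lemma Rsum_plus (u v : nat -> R) (n : nat) :
  sum_n (fun i => u i + v i) n = sum_n u n + sum_n v n.
Proof. exact (sum_n_plus (G := R_AbelianMonoid) u v n). Qed.

Lemma Rsum_S (u : nat -> R) (n : nat) :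
  sum_n u (S n) = sum_n u n + u (S n).
Proof. exact (sum_Sn (G := R_AbelianMonoid) u n). Qed.

Lemma Csum_S (u : nat -> C) (n : nat) :
  sum_n u (S n) = (sum_n u n + u (S n))%C.
Proof. exact (sum_Sn (G := C_AbelianMonoid) u n). Qed.

Lemma Csum_S_l (u : nat -> C) (n : nat) :
  sum_n u (S n) = (u 0%nat + sum_n (fun i => u (S i)) n)%C.
Proof. exact (sum_n_S_l (G := C_AbelianMonoid) u n). Qed.

Lemma Rsum_S_l (u : nat -> R) (n : nat) :
  sum_n u (S n) = u 0%nat + sum_n (fun i => u (S i)) n.
Proof. exact (sum_n_S_l (G := R_AbelianMonoid) u n). Qed.

Lemma sum_n_zero_loc {G : AbelianMonoid} (u : nat -> G) (n : nat) :
  (forall i, (i <= n)%nat -> u i = zero) -> sum_n u n = zero.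
Proof.
  intros Hu. rewrite (sum_n_ext_loc u (fun _ => zero) n Hu).
  apply sum_n_m_const_zero.
Qed.

Lemma Rsum_le_loc (u v : nat -> R) (n : nat) :
  (forall i, (i <= n)%nat -> u i <= v i) -> sum_n u n <= sum_n v n.
Proof.
  induction n as [|n IH]; intros H.
  - rewrite !sum_O. now apply H.
  - rewrite !Rsum_S. apply Rplus_le_compat; [apply IH; intros; apply H | apply H]; lia.
Qed.

Lemma Rsum_nonneg (u : nat -> R) (n : nat) :
  (forall i, 0 <= u i) -> 0 <= sum_n u n.
Proof.
  intros H. induction n as [|n IH].
  - now rewrite sum_O.
  - rewrite Rsum_S. specialize (H (S n)). lra.
Qed.

Lemma Rsum_le_length (u : nat -> R) (n m : nat) :
  (forall i, 0 <= u i) -> (n <= m)%nat -> sum_n u n <= sum_n u m.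
Proof.
  intros H Hnm. induction Hnm as [|m Hnm IH]; [lra|].
  rewrite Rsum_S. specialize (H (S m)). lra.
Qed.

Lemma sum_n_reverse {G : AbelianMonoid} (u : nat -> G) (n : nat) :
  sum_n (fun i => u (n - i)%nat) n = sum_n u n.
Proof.
  induction n as [|n IH]; [now rewrite !sum_O|].
  rewrite sum_n_S_l, sum_Sn, plus_comm. simpl Nat.sub.
  now rewrite IH.
Qed.

Lemma pow_le_1 (x : R) (n : nat) : 0 <= x <= 1 -> x ^ n <= 1.
Proof. intros Hx. rewrite <- (pow1 n). now apply pow_incr. Qed.

Lemma Re_sum_n (u : nat -> C) (n : nat) :
  Re (sum_n u n) = sum_n (fun i => Re (u i)) n.
Proof.
  induction n as [|n IH]; [now rewrite !sum_O|].
  rewrite Csum_S, Rsum_S, <- IH. reflexivity.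
Qed.

Lemma Cmod_sum_le (u : nat -> C) (n : nat) :
  Cmod (sum_n u n) <= sum_n (fun i => Cmod (u i)) n.
Proof. exact (norm_sum_n_m (V := C_NormedModule) u 0 n). Qed.

(** The cross term is kept as the real part of a product, so that its mean
    over a set of nodes can be computed by complex linearity. *)
Lemma Cmod_sqr_plus (x y : C) :
  Cmod (x + y) ^ 2 = Cmod x ^ 2 + Cmod y ^ 2 + 2 * Re (Cconj x * y)%C.
Proof.
  rewrite !Cmod2_alt. destruct x, y. unfold Re, Im. simpl. ring.
Qed.

(** * Parseval's identity at the roots of unity *)

Lemma primitive_root (N : nat) :
  exists q : C, Cmod q = 1 /\ (q ^ S N = 1)%C /\
    forall n, (0 < n <= N)%nat -> (q ^ n)%C <> 1%C.
Proof.
  set (t := 2 * PI / INR (S N)).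
  assert (HM : 0 < INR (S N)) by (apply lt_0_INR; lia).
  assert (Hpow : forall n, (((cos t, sin t) : C) ^ n)%C = (cos (INR n * t), sin (INR n * t))).
  { induction n as [|n IH].
    - simpl. now rewrite Rmult_0_l, cos_0, sin_0.
    - rewrite Cpow_S, IH, S_INR. unfold Cmult; simpl.
      replace ((INR n + 1) * t) with (t + INR n * t) by ring.
      rewrite cos_plus, sin_plus. f_equal; ring. }
  exists (cos t, sin t). split; [|split].
  - pose proof (sin2_cos2 t) as H. unfold Rsqr in H.
    unfold Cmod; simpl. rewrite !Rmult_1_r, Rplus_comm, H. apply sqrt_1.
  - rewrite Hpow. unfold t.
    replace (INR (S N) * (2 * PI / INR (S N))) with (2 * PI) by (field; lra).
    now rewrite cos_2PI, sin_2PI.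
  - intros n Hn Heq. rewrite Hpow in Heq.
    apply (f_equal fst) in Heq. simpl in Heq.
    assert (Ht : INR n * t = 2 * (PI * (INR n / INR (S N)))) by (unfold t; field; lra).
    rewrite Ht, cos_2a_sin in Heq.
    assert (Hn0 : 0 < INR n) by (apply lt_0_INR; lia).
    assert (HnM : INR n < INR (S N)) by (apply lt_INR; lia).
    assert (Hq : 0 < INR n / INR (S N) < 1).
    { split; [now apply Rdiv_lt_0_compat|]. apply (Rdiv_lt_1 _ _ HM); lra. }
    pose proof PI_RGT_0 as HPI.
    assert (Hs : 0 < sin (PI * (INR n / INR (S N)))) 
      by (apply sin_gt_0; [apply Rmult_lt_0_compat|
        rewrite <- (Rmult_1_r PI) at 2; apply Rmult_lt_compat_l]; lra).
    nra.
Qed.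

Lemma sum_geom (s : C) (n : nat) :
  ((1 - s) * sum_n (fun j => s ^ j) n = 1 - s ^ S n)%C.
Proof.
  induction n as [|n IH].
  - rewrite sum_O. simpl. ring.
  - rewrite Csum_S, Cmult_plus_distr_l, IH. simpl. ring.
Qed.

Lemma sum_root_powers (q : C) (N n : nat) :
  (q ^ S N = 1)%C -> (q ^ n)%C <> 1%C ->
  sum_n (fun j => (q ^ j) ^ n)%C N = RtoC 0.
Proof.
  intros Hq Hn.
  assert (H : ((1 - q ^ n) * sum_n (fun j => (q ^ j) ^ n) N = 0)%C).
  { rewrite (sum_n_ext _ (fun j => (q ^ n) ^ j)%C).
    2: { intros j. now rewrite <- !Cpow_mult_r, Nat.mul_comm. }
    rewrite sum_geom, <- Cpow_mult_r, Nat.mul_comm, Cpow_mult_r, Hq, Cpow_1_l. ring. }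
  assert (H1 : (1 - q ^ n)%C <> 0%C).
  { intros E. apply Hn. replace (q ^ n)%C with (1 - (1 - q ^ n))%C by ring.
    rewrite E. ring. }
  replace (sum_n (fun j => (q ^ j) ^ n)%C N) with
    (/ (1 - q ^ n) * ((1 - q ^ n) * sum_n (fun j => (q ^ j) ^ n) N))%C
    by (field; exact H1).
  rewrite H. apply Cmult_0_r.
Qed.

(** Peel off the constant coefficient: [P w = d_0 + w * P1 w].  On the unit
    circle [|P|^2 = |d_0|^2 + |P1|^2] plus a cross term, linear in
    [w * P1 w]; this polynomial has no constant coefficient and degree at most
    [N], so its mean over the [N+1] roots of unity is zero. *)
Lemma parseval_roots (q : C) (N : nat) :
  Cmod q = 1 -> (q ^ S N = 1)%C ->
  (forall n, (0 < n <= N)%nat -> (q ^ n)%C <> 1%C) ->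
  forall (n : nat) (d : nat -> C), (n <= N)%nat ->
  sum_n (fun j => Cmod (sum_n (fun i => d i * (q ^ j) ^ i)%C n) ^ 2) N =
  INR (S N) * sum_n (fun i => Cmod (d i) ^ 2) n.
Proof.
  intros Hq1 HqN Hqn. induction n as [|n IH]; intros d Hn.
  - rewrite sum_O, (sum_n_ext _ (fun _ => Cmod (d 0%nat) ^ 2)).
    + apply sum_n_const.
    + intros j. rewrite sum_O. simpl Cpow. now rewrite Cmult_1_r.
  - set (P1 := fun j => sum_n (fun i => d (S i) * (q ^ j) ^ i)%C n).
    rewrite (sum_n_ext _ (fun j => Cmod (d 0%nat) ^ 2 + Cmod (P1 j) ^ 2 +
      2 * Re (Cconj (d 0%nat) * (q ^ j * P1 j))%C)).
    2: { intros j. rewrite Csum_S_l. simpl (_ ^ 0)%C. rewrite Cmult_1_r.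
         rewrite (sum_n_ext _ (fun i => q ^ j * (d (S i) * (q ^ j) ^ i))%C).
         2: { intros i. rewrite Cpow_S. cring. }
         rewrite Csum_mult_l, Cmod_sqr_plus, Cmod_mult, Cmod_pow, Hq1, pow1, Rmult_1_l.
         reflexivity. }
    rewrite !Rsum_plus, Rsum_mult_l, <- Re_sum_n, Csum_mult_l.
    assert (Hz : sum_n (fun j => q ^ j * P1 j)%C N = RtoC 0).
    { rewrite (sum_n_ext _ (fun j => sum_n (fun i => d (S i) * (q ^ j) ^ S i)%C n)).
      2: { intros j. unfold P1. rewrite <- Csum_mult_l. apply sum_n_ext. intros i.
           rewrite Cpow_S. cring. }
      rewrite sum_n_switch. apply (sum_n_zero_loc (G := C_AbelianMonoid)).
      intros i Hi. rewrite Csum_mult_l, sum_root_powers; [apply Cmult_0_r|exact HqN|].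
      apply Hqn. lia. }
    rewrite Hz, Cmult_0_r. unfold P1. rewrite (IH (fun i => d (S i))) by lia.
    rewrite Rsum_S_l, sum_n_const. simpl Re.
    match goal with |- @eq _ ?x ?y => change (@eq R x y) end. ring.
Qed.

(** Averaging a pointwise inequality over equidistributed nodes of the circle
    of radius [r] turns it into an inequality between coefficients.  The slack
    [eta] is what remains of a power series after it is cut to a polynomial. *)
Lemma parseval_le (r lam eta : R) (n m : nat) (d p : nat -> C) :
  0 <= r ->
  (forall w : C, Cmod w = r ->
     Cmod (sum_n (fun i => d i * w ^ i)%C n) ^ 2 <=
     lam * Cmod (sum_n (fun j => p j * w ^ j)%C m) ^ 2 + eta) ->
  sum_n (fun i => Cmod (d i) ^ 2 * r ^ (2 * i)) n <=
  lam * sum_n (fun j => Cmod (p j) ^ 2 * r ^ (2 * j)) m + eta.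
Proof.
  intros Hr H. set (N := (n + m)%nat).
  destruct (primitive_root N) as (q & Hq1 & HqN & Hqn).
  assert (Hs : forall (e : nat -> C) (l : nat), (l <= N)%nat ->
    sum_n (fun j => Cmod (sum_n (fun i => e i * (RtoC r * q ^ j) ^ i)%C l) ^ 2) N =
    INR (S N) * sum_n (fun i => Cmod (e i) ^ 2 * r ^ (2 * i)) l).
  { intros e l Hl.
    rewrite (sum_n_ext _ (fun j => Cmod (sum_n (fun i => (e i * RtoC r ^ i) * (q ^ j) ^ i)%C l) ^ 2)).
    2: { intros j. do 2 f_equal. apply sum_n_ext. intros i. rewrite Cpow_mult_l. cring. }
    rewrite (parseval_roots q N Hq1 HqN Hqn l (fun i => e i * RtoC r ^ i)%C Hl).
    f_equal. apply sum_n_ext. intros i.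
    rewrite Cmod_mult, Cmod_pow, Cmod_R, Rabs_pos_eq, Rpow_mult_distr, <- pow_mult by exact Hr.
    now rewrite (Nat.mul_comm i). }
  assert (HM : 0 < INR (S N)) by (apply lt_0_INR; lia).
  apply Rmult_le_reg_l with (1 := HM).
  rewrite Rmult_plus_distr_l, <- Rmult_assoc, (Rmult_comm _ lam), Rmult_assoc.
  rewrite <- !Hs by (unfold N; lia). rewrite <- sum_n_const, <- Rsum_mult_l, <- Rsum_plus.
  apply Rsum_le_loc. intros j _. apply H.
  rewrite Cmod_mult, Cmod_pow, Hq1, pow1, Cmod_R, Rabs_pos_eq; lra.
Qed.

(** * Products of power series with polynomials *)

Notation is_Cseries := (is_series (K := C_AbsRing) (V := C_NormedModule)).

Lemma is_Cseries_partial (u : nat -> C) (l : C) :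
  is_Cseries u l ->
  forall eps, 0 < eps -> eventually (fun n => Cmod (sum_n u n - l)%C < eps).
Proof.
  intros H eps Heps.
  exact (proj1 (filterlim_locally_ball_norm (U := C_NormedModule) _ _) H (mkposreal eps Heps)).
Qed.

Lemma is_Cseries_bounded (u : nat -> C) (l : C) :
  is_Cseries u l -> exists B, 0 <= B /\ forall n, Cmod (u n) <= B.
Proof.
  intros H.
  destruct (filterlim_bounded (V := C_NormedModule) (sum_n u) (ex_intro _ l H)) as [B HB].
  change (forall n, Cmod (sum_n u n) <= B) in HB.
  assert (HB0 : 0 <= B) by (generalize (HB 0%nat) (Cmod_ge_0 (sum_n u 0)); lra).
  exists (2 * B). split; [lra|]. intros [|n].
  - generalize (HB 0%nat). rewrite sum_O. lra.
  - replace (u (S n)) with (sum_n u (S n) + - sum_n u n)%C by (rewrite Csum_S; cring).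
    eapply Rle_trans; [apply Cmod_triangle|]. rewrite Cmod_opp.
    generalize (HB n) (HB (S n)). lra.
Qed.

(** The bound depends on the terms only through [B] and [th], hence is uniform
    over a circle: this is what lets a series be replaced by its partial sums
    at all the nodes at once. *)
Lemma is_Cseries_tail (u : nat -> C) (l : C) (B th : R) :
  0 <= th < 1 -> 0 <= B -> is_Cseries u l -> (forall n, Cmod (u n) <= B * th ^ n) ->
  forall K, Cmod (sum_n u K - l)%C <= B * th ^ S K / (1 - th).
Proof.
  intros Hth HB Hu Hb K.
  assert (Hd : forall n, Cmod (sum_n u K - sum_n u (K + n)%nat)%C <=
    B * (th ^ S K - th ^ S (K + n)) / (1 - th)).
  { induction n as [|n IH].
    - rewrite Nat.add_0_r. replace (sum_n u K - sum_n u K)%C with (RtoC 0) by cring.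
      rewrite Cmod_0. right. field. lra.
    - rewrite Nat.add_succ_r, Csum_S.
      replace (sum_n u K - (sum_n u (K + n) + u (S (K + n))))%C with
        ((sum_n u K - sum_n u (K + n)) + - u (S (K + n)))%C by cring.
      eapply Rle_trans; [apply Cmod_triangle|]. rewrite Cmod_opp.
      eapply Rle_trans; [apply Rplus_le_compat; [exact IH|apply Hb]|].
      right. simpl. field. lra. }
  apply le_epsilon. intros eps Heps.
  destruct (is_Cseries_partial u l Hu eps Heps) as [n0 Hn0].
  replace (sum_n u K - l)%C with
    ((sum_n u K - sum_n u (K + n0)%nat) + (sum_n u (K + n0)%nat - l))%C by cring.
  eapply Rle_trans; [apply Cmod_triangle|].
  apply Rplus_le_compat; [|left; apply Hn0; lia].
  eapply Rle_trans; [apply Hd|]. unfold Rdiv.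
  apply Rmult_le_compat_r; [left; apply Rinv_0_lt_compat; lra|].
  apply Rmult_le_compat_l; [exact HB|].
  assert (0 <= th ^ S (K + n0)) by (apply pow_le; lra). lra.
Qed.

Definition conv (p c : nat -> C) (i : nat) : C :=
  sum_n (fun j => p j * c (i - j)%nat)%C i.

Lemma conv_S (p c : nat -> C) (i : nat) :
  conv p c (S i) = (p 0%nat * c (S i) + conv (fun j => p (S j)) c i)%C.
Proof. unfold conv. now rewrite Csum_S_l. Qed.

(** With a polynomial as one factor, the Cauchy product is a finite
    combination of shifts of one convergent series; the induction on the degree
    bound [J] removes one shift at a time. *)
Lemma is_Cseries_conv (c : nat -> C) (w l : C) :
  is_Cseries (fun i => c i * w ^ i)%C l ->
  forall (J : nat) (p : nat -> C), (forall j, (J < j)%nat -> p j = 0%C) ->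
  is_Cseries (fun i => conv p c i * w ^ i)%C (sum_n (fun j => p j * w ^ j)%C J * l)%C.
Proof.
  intros Hc. induction J as [|J IH]; intros p Hp.
  - rewrite sum_O. simpl Cpow. rewrite Cmult_1_r.
    apply is_series_ext with (a := fun i => scal (p 0%nat) (c i * w ^ i)%C).
    2: now apply (is_series_scal (K := C_AbsRing) (V := C_NormedModule)).
    intros i. change (p 0%nat * (c i * w ^ i) = conv p c i * w ^ i)%C.
    rewrite Cmult_assoc. f_equal. destruct i as [|i].
    + unfold conv. now rewrite sum_O.
    + rewrite conv_S. unfold conv. rewrite (sum_n_zero_loc (G := C_AbelianMonoid)).
      * symmetry. apply Cplus_0_r.
      * intros j _. rewrite Hp by lia. apply Cmult_0_l.
  - set (q := fun j => p (S j)).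
    assert (Hq : forall j, (J < j)%nat -> q j = 0%C) by (intros; apply Hp; lia).
    specialize (IH q Hq).
    assert (Hsh : is_Cseries (fun i => match i with O => RtoC 0 | S i => w * (conv q c i * w ^ i) end)%C
                 (w * (sum_n (fun j => q j * w ^ j) J * l))%C).
    { apply is_series_decr_1.
      replace (plus _ _) with (w * (sum_n (fun j => q j * w ^ j) J * l))%C.
      - exact (is_series_scal (K := C_AbsRing) (V := C_NormedModule) w _ _ IH).
      - symmetry.
        transitivity (w * (sum_n (fun j => q j * w ^ j) J * l) + - 0)%C; [reflexivity|cring]. }
    replace (sum_n (fun j => p j * w ^ j)%C (S J) * l)%C with
      (p 0%nat * l + w * (sum_n (fun j => q j * w ^ j) J * l))%C.
    2: { rewrite Csum_S_l.
         rewrite (sum_n_ext (fun i => p (S i) * w ^ S i)%C (fun i => w * (q i * w ^ i))%C).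
         - rewrite Csum_mult_l. simpl Cpow. cring.
         - intros i. unfold q. rewrite Cpow_S. cring. }
    eapply is_series_ext.
    2: exact (is_series_plus (K := C_AbsRing) (V := C_NormedModule) _ _ _ _
         (is_series_scal (K := C_AbsRing) (V := C_NormedModule) (p 0%nat) _ _ Hc) Hsh).
    intros [|i].
    + change (p 0%nat * (c 0%nat * w ^ 0) + 0 = conv p c 0 * w ^ 0)%C.
      unfold conv. rewrite sum_O. simpl. ring.
    + change (p 0%nat * (c (S i) * w ^ S i) + w * (conv q c i * w ^ i) = conv p c (S i) * w ^ S i)%C.
      rewrite conv_S. unfold q. rewrite Cpow_S. ring.
Qed.

Lemma one_sub_pow_le (e : R) (N : nat) : 0 <= e <= 1 -> 1 - INR N * e <= (1 - e) ^ N.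
Proof.
  intros He. induction N as [|N IH]; [simpl; lra|].
  rewrite S_INR. simpl.
  assert (0 <= INR N) by apply pos_INR.
  assert (0 <= (1 - e) ^ N) by (apply pow_le; lra). nra.
Qed.

(** On [|w| = r] the function [P * h] is bounded by [r^(-k) * |P|].  Its partial
    sums converge to it uniformly there, so that Parseval applies to them with
    a slack that tends to zero with their length. *)
Lemma conv_norm_radius (c p : nat -> C) (h : C -> C) (k J L : nat) (r : R) :
  (forall w, 0 < Cmod w < 1 ->
     is_Cseries (fun m => c m * w ^ m)%C (h w) /\ Cmod (w ^ k * h w)%C <= 1) ->
  (forall j, (J < j)%nat -> p j = 0%C) ->
  0 < r < 1 ->
  sum_n (fun i => Cmod (conv p c i) ^ 2 * r ^ (2 * i)) L <=
  (/ r ^ k) ^ 2 * sum_n (fun j => Cmod (p j) ^ 2 * r ^ (2 * j)) J.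
Proof.
  intros Hh Hp Hr.
  set (P := fun w : C => sum_n (fun j => p j * w ^ j)%C J).
  set (e := conv p c).
  (* Convergence at the larger radius s bounds the terms at radius r by a
     geometric sequence of ratio th = r / s. *)
  set (s := (1 + r) / 2). set (th := r / s).
  assert (Hs : r < s < 1) by (unfold s; lra).
  assert (Hth : 0 <= th < 1).
  { unfold th. split; [left; apply Rdiv_lt_0_compat; lra|]. apply (Rdiv_lt_1 r s); lra. }
  assert (Hr' : Cmod (RtoC s) = s) by (rewrite Cmod_R, Rabs_pos_eq; lra).
  destruct (Hh (RtoC s)) as [Hser _]; [rewrite Hr'; lra|].
  destruct (is_Cseries_bounded _ _ (is_Cseries_conv c _ _ Hser J p Hp)) as (B & HB0 & HB).
  set (lam := / r ^ k).
  assert (Hlam : 0 < lam) by (apply Rinv_0_lt_compat, pow_lt; lra).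
  set (BP := sum_n (fun j => Cmod (p j)) J).
  set (del := fun K => B * th ^ S K / (1 - th)).
  assert (Hdel0 : forall K, 0 <= del K).
  { intros K. unfold del, Rdiv. apply Rmult_le_pos; [apply Rmult_le_pos; [lra|apply pow_le; lra]|].
    left. apply Rinv_0_lt_compat. lra. }
  assert (Hpt : forall K w, Cmod w = r ->
    Cmod (sum_n (fun i => e i * w ^ i)%C K) ^ 2 <=
    lam ^ 2 * Cmod (P w) ^ 2 + del K * (2 * lam * BP + del K)).
  { intros K w Hw.
    destruct (Hh w) as [Hserw Hbw]; [lra|].
    pose proof (is_Cseries_conv c _ _ Hserw J p Hp) as Hcw.
    assert (Hterm : forall n, Cmod (e n * w ^ n)%C <= B * th ^ n).
    { intros n. specialize (HB n). rewrite Cmod_mult, Cmod_pow in HB |- *.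
      rewrite Hr' in HB. rewrite Hw. replace r with (s * th) by (unfold th; field; lra).
      rewrite Rpow_mult_distr, <- Rmult_assoc.
      apply Rmult_le_compat_r; [apply pow_le; lra|exact HB]. }
    pose proof (is_Cseries_tail _ _ B th Hth HB0 Hcw Hterm K) as Ht.
    fold (P w) in Ht. fold (del K) in Ht. change (conv p c) with e in Ht.
    set (SK := sum_n (fun i => e i * w ^ i)%C K) in *.
    assert (Hhw : Cmod (h w) <= lam).
    { rewrite Cmod_mult, Cmod_pow, Hw in Hbw. unfold lam.
      assert (0 < r ^ k) by (apply pow_lt; lra).
      apply Rmult_le_reg_l with (r ^ k); [lra|]. rewrite Rinv_r; lra. }
    assert (HP : Cmod (P w) <= BP).
    { unfold P, BP. eapply Rle_trans; [apply Cmod_sum_le|]. apply Rsum_le_loc.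
      intros j _. rewrite Cmod_mult, Cmod_pow, Hw.
      rewrite <- (Rmult_1_r (Cmod (p j))) at 2.
      apply Rmult_le_compat_l; [apply Cmod_ge_0|].
      apply pow_le_1. lra. }
    assert (HS : Cmod SK <= lam * Cmod (P w) + del K).
    { replace SK with ((SK - P w * h w) + P w * h w)%C by cring.
      eapply Rle_trans; [apply Cmod_triangle|]. rewrite Cmod_mult.
      generalize (Cmod_ge_0 (P w)). nra. }
    generalize (Cmod_ge_0 SK) (Cmod_ge_0 (P w)) (Hdel0 K). intros H1 H2 H3.
    apply Rle_trans with ((lam * Cmod (P w) + del K) ^ 2); [apply pow_incr; lra|].
    assert (lam * del K * Cmod (P w) <= lam * del K * BP) by (apply Rmult_le_compat_l; [nra|exact HP]).
    nra. }
  set (X := lam ^ 2 * sum_n (fun j => Cmod (p j) ^ 2 * r ^ (2 * j)) J).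
  assert (HK : forall n, sum_n (fun i => Cmod (e i) ^ 2 * r ^ (2 * i)) L <=
     X + del (n + L)%nat * (2 * lam * BP + del (n + L)%nat)).
  { intros n. eapply Rle_trans; [|apply parseval_le; [lra|apply Hpt]].
    apply Rsum_le_length; [|lia]. intros i.
    apply Rmult_le_pos; [apply pow2_ge_0|apply pow_le; lra]. }
  assert (Hlim : is_lim_seq (fun n => del (n + L)%nat) 0).
  { apply (is_lim_seq_incr_n del L).
    apply is_lim_seq_ext with (fun K => B * th / (1 - th) * th ^ K).
    { intros K. unfold del. simpl. field. lra. }
    evar_last.
    { apply is_lim_seq_scal_l. apply is_lim_seq_geom. rewrite Rabs_pos_eq; lra. }
    simpl. f_equal. ring. }
  assert (Hlim2 : is_lim_seq (fun n => X + del (n + L)%nat * (2 * lam * BP + del (n + L)%nat)) X).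
  { evar_last.
    { apply is_lim_seq_plus'; [apply is_lim_seq_const|].
      apply is_lim_seq_mult'; [exact Hlim|].
      apply is_lim_seq_plus'; [apply is_lim_seq_const|exact Hlim]. }
    simpl. f_equal. ring. }
  exact (is_lim_seq_le _ _ (Finite _) (Finite _) HK (is_lim_seq_const _) Hlim2).
Qed.

(** Multiplication by a function bounded by 1 does not increase the norm of the
    Hardy space.  The factor [w^k] is harmless: it costs a power of [r] that
    tends to 1 with [r]. *)
Lemma conv_norm_le (c p : nat -> C) (h : C -> C) (k J L : nat) :
  (forall w, 0 < Cmod w < 1 ->
     is_Cseries (fun m => c m * w ^ m)%C (h w) /\ Cmod (w ^ k * h w)%C <= 1) ->
  (forall j, (J < j)%nat -> p j = 0%C) ->
  sum_n (fun i => Cmod (conv p c i) ^ 2) L <= sum_n (fun j => Cmod (p j) ^ 2) J.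
Proof.
  intros Hh Hp.
  set (X := sum_n (fun i => Cmod (conv p c i) ^ 2) L : R).
  set (Y := sum_n (fun j => Cmod (p j) ^ 2) J : R).
  assert (HX : 0 <= X) by (apply Rsum_nonneg; intros; apply pow2_ge_0).
  set (N := (2 * L + 2 * k)%nat).
  assert (Hr : forall r, 0 < r < 1 -> r ^ N * X <= Y).
  { intros r Hr.
    pose proof (conv_norm_radius c p h k J L r Hh Hp Hr) as H.
    assert (Hk : 0 < r ^ k) by (apply pow_lt; lra).
    assert (H1 : r ^ (2 * L) * X <= sum_n (fun i => Cmod (conv p c i) ^ 2 * r ^ (2 * i)) L).
    { unfold X. rewrite <- Rsum_mult_l. apply Rsum_le_loc. intros i Hi.
      rewrite Rmult_comm. apply Rmult_le_compat_l; [apply pow2_ge_0|].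
      replace (2 * L)%nat with (2 * i + (2 * L - 2 * i))%nat by lia. rewrite pow_add.
      rewrite <- (Rmult_1_r (r ^ (2 * i))) at 2.
      apply Rmult_le_compat_l; [apply pow_le; lra|].
      apply pow_le_1. lra. }
    assert (H2 : sum_n (fun j => Cmod (p j) ^ 2 * r ^ (2 * j)) J <= Y).
    { apply Rsum_le_loc. intros j _.
      rewrite <- (Rmult_1_r (Cmod (p j) ^ 2)) at 2.
      apply Rmult_le_compat_l; [apply pow2_ge_0|].
      apply pow_le_1. lra. }
    assert (H3 : r ^ (2 * L) * X <= (/ r ^ k) ^ 2 * Y).
    { eapply Rle_trans; [exact H1|]. eapply Rle_trans; [exact H|].
      apply Rmult_le_compat_l; [apply pow2_ge_0|exact H2]. }
    unfold N. rewrite pow_add, (Nat.mul_comm 2 k), (pow_mult r k 2).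
    apply Rmult_le_compat_l with (r := (r ^ k) ^ 2) in H3; [|apply pow2_ge_0].
    replace ((r ^ k) ^ 2 * ((/ r ^ k) ^ 2 * Y)) with Y in H3 by (field; lra).
    lra. }
  (* If Y < X then r = 1 - eps refutes r^N X <= Y by Bernoulli's inequality, as
     soon as N eps X < X - Y; the denominator D also keeps eps below 1. *)
  destruct (Rle_or_lt X Y) as [|Hlt]; [assumption|exfalso].
  assert (HN : 0 <= INR N) by apply pos_INR.
  set (D := X * (INR N + 1) + (X - Y)).
  assert (HD : 0 < D) by (unfold D; nra).
  set (eps := (X - Y) / D).
  assert (He : eps * D = X - Y) by (unfold eps; field; lra).
  assert (He0 : 0 < eps) by (apply Rdiv_lt_0_compat; lra).
  assert (HX0 : 0 < X) by (specialize (Hr (1 / 2)); assert (0 <= Y) by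
    (apply Rsum_nonneg; intros; apply pow2_ge_0); lra).
  assert (He1 : eps < 1) by (apply (Rdiv_lt_1 _ _ HD); unfold D; nra).
  specialize (Hr (1 - eps)). pose proof (one_sub_pow_le eps N).
  unfold D in He.
  assert ((1 - INR N * eps) * X <= Y).
  { eapply Rle_trans; [|apply Hr; lra]. apply Rmult_le_compat_r; lra. }
  nra.
Qed.

(** * Carlson's coefficient inequalities *)

(** The lower triangular Toeplitz matrix of [c] is a contraction: it is stated
    on finitely supported inputs [p] and on truncations of the output. *)
Definition contractive (c : nat -> C) : Prop :=
  forall (p : nat -> C) (J L : nat), (forall j, (J < j)%nat -> p j = 0%C) ->
  sum_n (fun i => Cmod (conv p c i) ^ 2) L <= sum_n (fun j => Cmod (p j) ^ 2) J.

Lemma sum_n_zero_tail {G : AbelianMonoid} (u : nat -> G) (n m : nat) :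
  (n <= m)%nat -> (forall i, (n < i)%nat -> u i = zero) -> sum_n u m = sum_n u n.
Proof.
  intros Hnm Hu. induction Hnm as [|m Hnm IH]; [reflexivity|].
  rewrite sum_Sn, IH, Hu by lia. apply plus_zero_r.
Qed.

Lemma unit_phase (z : C) : exists e : C, Cmod e = 1 /\ z = (e * RtoC (Cmod z))%C.
Proof.
  destruct (Req_dec (Cmod z) 0) as [H|H].
  - exists 1%C. split; [apply Cmod_1|]. rewrite H, Cmult_0_r. now apply Cmod_eq_0.
  - assert (Hz : RtoC (Cmod z) <> 0%C) by (intros E; apply H; now injection E).
    exists (z / RtoC (Cmod z))%C. split.
    + rewrite Cmod_div, Cmod_R, Rabs_pos_eq by (exact Hz || apply Cmod_ge_0). now field.
    + now field.
Qed.

(** The input [1 + w * V w] on which contractivity is tested.  Its entry of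
    index [S i] is aligned in phase with the factor [c (N - i)] that it meets
    in the output of index [S N], where all the products then add up in
    modulus.  When the weights [tau] vanish beyond [n], the first [N - n]
    entries after the leading 1 are zero, so the low outputs are those of the
    input 1. *)
Definition probe (e : C) (tau : nat -> R) (c : nat -> C) (N : nat) (j : nat) : C :=
  match j with
  | O => 1%C
  | S i => if (i <=? N)%nat then (e * RtoC (tau (N - i)%nat) * Cconj (c (N - i)%nat))%C else 0%C
  end.

Lemma conv_probe_low (e : C) (tau : nat -> R) (c : nat -> C) (N n i : nat) :
  (forall j, (n < j)%nat -> tau j = 0) -> (i + n <= N)%nat ->
  conv (probe e tau c N) c i = c i.
Proof.
  intros Htau Hi. destruct i as [|i].
  - unfold conv. rewrite sum_O. simpl. apply Cmult_1_l.
  - rewrite conv_S. simpl probe at 1. unfold conv. rewrite (sum_n_zero_loc (G := C_AbelianMonoid)).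
    + rewrite Cmult_1_l. apply Cplus_0_r.
    + intros j Hj. simpl. destruct (j <=? N)%nat.
      * rewrite Htau by lia. rewrite Cmult_0_r, Cmult_0_l. apply Cmult_0_l.
      * apply Cmult_0_l.
Qed.

(** The first output where the weighted part of the input is felt: only its
    entry of weight [tau n] contributes, multiplied by [c 0]. *)
Lemma conv_probe_edge (e : C) (tau : nat -> R) (c : nat -> C) (N n : nat) :
  (forall j, (n < j)%nat -> tau j = 0) -> (n <= N)%nat ->
  conv (probe e tau c N) c (S (N - n)) =
  (c (S (N - n)) + e * RtoC (tau n) * Cconj (c n) * c 0%nat)%C.
Proof.
  intros Htau Hn. rewrite conv_S. simpl probe at 1. rewrite Cmult_1_l. f_equal.
  unfold conv.
  assert (Hlast : probe e tau c N (S (N - n)) = (e * RtoC (tau n) * Cconj (c n))%C).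
  { simpl. replace (N - n <=? N)%nat with true by (symmetry; apply Nat.leb_le; lia).
    now replace (N - (N - n))%nat with n by lia. }
  destruct (N - n)%nat as [|i] eqn:Ei.
  - now rewrite sum_O, Hlast.
  - rewrite Csum_S, (sum_n_zero_loc (G := C_AbelianMonoid)), Nat.sub_diag, Hlast.
    + apply Cplus_0_l.
    + intros j Hj. simpl. destruct (j <=? N)%nat.
      * rewrite Htau by lia. rewrite Cmult_0_r, Cmult_0_l. apply Cmult_0_l.
      * apply Cmult_0_l.
Qed.

Lemma conv_probe_top (e : C) (tau : nat -> R) (c : nat -> C) (N n : nat) :
  (forall j, (n < j)%nat -> tau j = 0) -> (n <= N)%nat -> Cmod e = 1 ->
  c (S N) = (e * RtoC (Cmod (c (S N))))%C ->
  Cmod (conv (probe e tau c N) c (S N)) =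
  Rabs (Cmod (c (S N)) + sum_n (fun i => tau i * Cmod (c i) ^ 2) n).
Proof.
  intros Htau Hn He Hc. rewrite conv_S. simpl probe at 1. rewrite Cmult_1_l.
  assert (Hs : conv (fun j => probe e tau c N (S j)) c N =
    (e * RtoC (sum_n (fun i => tau i * Cmod (c i) ^ 2)%R n))%C).
  { unfold conv.
    rewrite (sum_n_ext_loc _ (fun j => e * RtoC (tau (N - j)%nat * Cmod (c (N - j)%nat) ^ 2)%R)%C).
    - rewrite (sum_n_reverse (fun i => e * RtoC (tau i * Cmod (c i) ^ 2)%R)%C).
      rewrite Csum_mult_l. f_equal.
      rewrite (sum_n_zero_tail (G := C_AbelianMonoid) _ n N Hn).
      + clear. induction n as [|n IH]; [now rewrite !sum_O|].
        rewrite Csum_S, Rsum_S, RtoC_plus. now rewrite IH.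
      + intros i Hi. now rewrite Htau, Rmult_0_l by exact Hi.
    - intros j Hj. simpl probe. replace (j <=? N)%nat with true by (symmetry; apply Nat.leb_le; lia).
      rewrite RtoC_mult, Cmod2_conj. cring. }
  rewrite Hs, Hc at 1. rewrite <- Cmult_plus_distr_l, <- RtoC_plus, Cmod_mult, He, Cmod_R.
  apply Rmult_1_l.
Qed.

Lemma norm_probe (e : C) (tau : nat -> R) (c : nat -> C) (N n : nat) :
  (forall j, (n < j)%nat -> tau j = 0) -> (n <= N)%nat -> Cmod e = 1 ->
  sum_n (fun j => Cmod (probe e tau c N j) ^ 2) (S N) =
  1 + sum_n (fun i => tau i ^ 2 * Cmod (c i) ^ 2) n.
Proof.
  intros Htau Hn He. rewrite Rsum_S_l. simpl probe at 1. rewrite Cmod_1, pow1. f_equal.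
  rewrite (sum_n_ext_loc _ (fun j => tau (N - j)%nat ^ 2 * Cmod (c (N - j)%nat) ^ 2)).
  - rewrite (sum_n_reverse (fun i => tau i ^ 2 * Cmod (c i) ^ 2)).
    apply (sum_n_zero_tail (G := R_AbelianMonoid) _ n N Hn).
    intros i Hi. rewrite Htau by exact Hi. change (0 ^ 2 * Cmod (c i) ^ 2 = 0). ring.
  - intros j Hj. simpl probe. replace (j <=? N)%nat with true by (symmetry; apply Nat.leb_le; lia).
    rewrite !Cmod_mult, Cmod_conj, He, Cmod_R, Rmult_1_l, Rpow_mult_distr, pow2_abs. reflexivity.
Qed.

(** With unit weights on [0..n] and [X] the sum of the squares, the output of
    the probe has square norm at least [X + (|c_(2n+1)| + X)^2] and its input
    has square norm [1 + X]. *)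
Lemma carlson_odd (c : nat -> C) (n : nat) :
  contractive c ->
  Cmod (c (2 * n + 1)%nat) + sum_n (fun i => Cmod (c i) ^ 2) n <= 1.
Proof.
  intros Hc. replace (2 * n + 1)%nat with (S (2 * n)) by lia. set (N := (2 * n)%nat).
  set (tau := fun i => if (i <=? n)%nat then 1 else 0).
  assert (Htau : forall j, (n < j)%nat -> tau j = 0).
  { intros j Hj. unfold tau. now replace (j <=? n)%nat with false by (symmetry; apply Nat.leb_gt; lia). }
  assert (Htau1 : forall j, (j <= n)%nat -> tau j = 1).
  { intros j Hj. unfold tau. now replace (j <=? n)%nat with true by (symmetry; apply Nat.leb_le; lia). }
  assert (Hn : (n <= N)%nat) by (unfold N; lia).
  destruct (unit_phase (c (S N))) as (e & He & Hph).
  pose proof (Hc (probe e tau c N) (S N) (S N)) as H.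
  rewrite (norm_probe e tau c N n Htau Hn He), Rsum_S,
    (conv_probe_top e tau c N n Htau Hn He Hph), pow2_abs in H.
  set (X := sum_n (fun i => Cmod (c i) ^ 2) n : R).
  rewrite (sum_n_ext_loc (fun i => tau i * Cmod (c i) ^ 2) (fun i => Cmod (c i) ^ 2) n) in H
    by (intros i Hi; rewrite Htau1 by exact Hi; apply Rmult_1_l).
  rewrite (sum_n_ext_loc (fun i => tau i ^ 2 * Cmod (c i) ^ 2) (fun i => Cmod (c i) ^ 2) n) in H
    by (intros i Hi; rewrite Htau1, pow1 by exact Hi; apply Rmult_1_l).
  fold X in H.
  assert (Hlow : X <= sum_n (fun i => Cmod (conv (probe e tau c N) c i) ^ 2) N).
  { unfold X. eapply Rle_trans; [|apply Rsum_le_length with (n := n); [intros; apply pow2_ge_0|exact Hn]].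
    apply Rsum_le_loc. intros i Hi.
    rewrite (conv_probe_low e tau c N n i Htau) by (unfold N; lia). lra. }
  assert (HX : 0 <= X) by (apply Rsum_nonneg; intros; apply pow2_ge_0).
  pose proof (Cmod_ge_0 (c (S N))).
  assert (H' : (Cmod (c (S N)) + X) ^ 2 <= 1).
  { enough (1 + X >= X + (Cmod (c (S N)) + X) ^ 2) by lra.
    apply Rle_ge. eapply Rle_trans; [|apply H].
    - apply Rplus_le_compat_r. exact Hlow.
    - intros j Hj. destruct j as [|j]; [lia|]. simpl.
      now replace (j <=? N)%nat with false by (symmetry; apply Nat.leb_gt; lia). }
  change (Cmod (c (S N)) + X <= 1). nra.
Qed.

(** Here the weighted part of the probe starts at index [n+1], where it
    perturbs the output [c_(n+1)] by at most [t |c_(n+1)| |c_0|], with [t] the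
    weight of this entry.  The loss is balanced when [1 - t |c_0| = t], that is
    [t = 1/(1 + |c_0|)]: then [t^2 |c_(n+1)|^2] occurs on both sides, and the
    rest is as in the odd case. *)
Lemma carlson_even (c : nat -> C) (n : nat) :
  contractive c ->
  Cmod (c (2 * n + 2)%nat) + sum_n (fun i => Cmod (c i) ^ 2) n +
  Cmod (c (S n)) ^ 2 / (1 + Cmod (c 0%nat)) <= 1.
Proof.
  intros Hc. replace (2 * n + 2)%nat with (S (2 * n + 1)) by lia. set (N := (2 * n + 1)%nat).
  set (a := Cmod (c 0%nat)). set (t := / (1 + a)).
  assert (Ha : 0 <= a) by apply Cmod_ge_0.
  assert (Ht : 0 < t) by (apply Rinv_0_lt_compat; lra).
  assert (Hta : 1 - t * a = t) by (unfold t; field; lra).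
  set (tau := fun i => if (i <=? n)%nat then 1 else if (i =? S n)%nat then t else 0).
  assert (Htau : forall j, (S n < j)%nat -> tau j = 0).
  { intros j Hj. unfold tau. replace (j <=? n)%nat with false by (symmetry; apply Nat.leb_gt; lia).
    now replace (j =? S n)%nat with false by (symmetry; apply Nat.eqb_neq; lia). }
  assert (Htau1 : forall j, (j <= n)%nat -> tau j = 1).
  { intros j Hj. unfold tau. now replace (j <=? n)%nat with true by (symmetry; apply Nat.leb_le; lia). }
  assert (Htaut : tau (S n) = t).
  { unfold tau. replace (S n <=? n)%nat with false by (symmetry; apply Nat.leb_gt; lia).
    now rewrite Nat.eqb_refl. }
  assert (Hn : (S n <= N)%nat) by (unfold N; lia).
  destruct (unit_phase (c (S N))) as (e & He & Hph).
  pose proof (Hc (probe e tau c N) (S N) (S N)) as H.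
  rewrite (norm_probe e tau c N (S n) Htau Hn He), (Rsum_S _ N),
    (conv_probe_top e tau c N (S n) Htau Hn He Hph), pow2_abs in H.
  set (X := sum_n (fun i => Cmod (c i) ^ 2) n : R).
  rewrite !(Rsum_S _ n), Htaut in H.
  rewrite (sum_n_ext_loc (fun i => tau i * Cmod (c i) ^ 2) (fun i => Cmod (c i) ^ 2) n) in H
    by (intros i Hi; rewrite Htau1 by exact Hi; apply Rmult_1_l).
  rewrite (sum_n_ext_loc (fun i => tau i ^ 2 * Cmod (c i) ^ 2) (fun i => Cmod (c i) ^ 2) n) in H
    by (intros i Hi; rewrite Htau1, pow1 by exact Hi; apply Rmult_1_l).
  fold X in H. set (x := Cmod (c (S n))) in *.
  assert (Hx : 0 <= x) by apply Cmod_ge_0.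
  assert (Hedge : t * x <= Cmod (conv (probe e tau c N) c (S n))).
  { pose proof (conv_probe_edge e tau c N (S n) Htau Hn) as E.
    replace (N - S n)%nat with n in E by (unfold N; lia). rewrite E, Htaut.
    set (y := (e * RtoC t * Cconj (c (S n)) * c 0%nat)%C).
    assert (Hy : Cmod y = t * x * a).
    { unfold y. rewrite !Cmod_mult, Cmod_conj, He, Cmod_R, Rabs_pos_eq by lra. unfold x, a. ring. }
    assert (Htri : x <= Cmod (c (S n) + y)%C + Cmod y).
    { rewrite <- (Cmod_opp y). unfold x. replace (c (S n)) with ((c (S n) + y) + - y)%C at 1 by ring.
      apply Cmod_triangle. }
    rewrite Hy in Htri. replace t with (1 - t * a) at 1 by exact Hta. lra. }
  assert (Hlow : X + (t * x) ^ 2 <= sum_n (fun i => Cmod (conv (probe e tau c N) c i) ^ 2) N).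
  { eapply Rle_trans; [|apply Rsum_le_length with (n := S n); [intros; apply pow2_ge_0|exact Hn]].
    rewrite Rsum_S. apply Rplus_le_compat.
    - apply Rsum_le_loc. intros i Hi.
      rewrite (conv_probe_low e tau c N (S n) i Htau) by (unfold N; lia). lra.
    - apply pow_incr. split; [nra|exact Hedge]. }
  assert (HX : 0 <= X) by (apply Rsum_nonneg; intros; apply pow2_ge_0).
  pose proof (Cmod_ge_0 (c (S N))) as HcN.
  assert (H' : (Cmod (c (S N)) + (X + t * x ^ 2)) ^ 2 <= 1).
  { enough (1 + (X + t ^ 2 * x ^ 2) >= (X + (t * x) ^ 2) + (Cmod (c (S N)) + (X + t * x ^ 2)) ^ 2) by lra.
    apply Rle_ge. eapply Rle_trans; [|apply H].
    - apply Rplus_le_compat_r. exact Hlow.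
    - intros j Hj. destruct j as [|j]; [lia|]. simpl.
      now replace (j <=? N)%nat with false by (symmetry; apply Nat.leb_gt; lia). }
  assert (Hx2 : 0 <= t * x ^ 2) by (apply Rmult_le_pos; [lra|apply pow2_ge_0]).
  change (Cmod (c (S N)) + X + x ^ 2 / (1 + a) <= 1).
  replace (x ^ 2 / (1 + a)) with (t * x ^ 2) by (unfold t, Rdiv; ring). nra.
Qed.

(** * The refined Bohr inequality *)

Lemma contractive_coef_le_1 (c : nat -> C) (n : nat) : contractive c -> Cmod (c n) <= 1.
Proof.
  intros Hc. pose proof (carlson_odd c n Hc) as H.
  destruct n as [|n]; [rewrite sum_O in H|rewrite Rsum_S in H].
  - generalize (Cmod_ge_0 (c 0%nat)) (Cmod_ge_0 (c (2 * 0 + 1)%nat)). nra.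
  - generalize (Cmod_ge_0 (c (S n))) (Cmod_ge_0 (c (2 * S n + 1)%nat)).
    assert (0 <= sum_n (fun i => Cmod (c i) ^ 2) n) by
      (apply Rsum_nonneg; intros; apply pow2_ge_0). nra.
Qed.

(** Bounding [|c_n|] by Carlson's inequalities and summing against [rho^n], the
    square [|c_m|^2] is subtracted once with factor [rho^(2m) / (1 + |c_0|)], at
    the index [2m], and once with factor [rho^n] for each [n > 2m]: in total
    exactly the weight it has on the left.  The last term is the part of the
    bound reserved for the indices beyond [2M + 2]. *)
Lemma refined_bohr_partial (c : nat -> C) (rho : R) (M : nat) :
  contractive c -> 0 < rho < 1 ->
  sum_n (fun m => Cmod (c (S m)) * rho ^ S m) (2 * M + 1) +
  (1 / (1 + Cmod (c 0%nat)) + rho / (1 - rho)) *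
    sum_n (fun m => Cmod (c (S m)) ^ 2 * rho ^ (2 * S m)) M <=
  (1 - Cmod (c 0%nat) ^ 2) * (rho / (1 - rho)) -
  rho ^ (2 * M + 3) / (1 - rho) * (1 - sum_n (fun i => Cmod (c i) ^ 2) (S M)).
Proof.
  intros Hc Hrho. set (a := Cmod (c 0%nat)).
  assert (Ha : 0 <= a) by apply Cmod_ge_0.
  (* The entries of index 2n+1 and 2n+2, together with the square of index n+1,
     use up no more than the drop of the reserved part from n to n+1. *)
  assert (Hstep : forall n,
    Cmod (c (2 * n + 1)%nat) * rho ^ (2 * n + 1) + Cmod (c (2 * n + 2)%nat) * rho ^ (2 * n + 2) +
    (1 / (1 + a) + rho / (1 - rho)) * (Cmod (c (S n)) ^ 2 * rho ^ (2 * n + 2)) <=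
    rho ^ (2 * n + 1) / (1 - rho) * (1 - sum_n (fun i => Cmod (c i) ^ 2) n) -
    rho ^ (2 * n + 3) / (1 - rho) * (1 - sum_n (fun i => Cmod (c i) ^ 2) (S n))).
  { intros n. rewrite Rsum_S.
    pose proof (carlson_odd c n Hc) as H1. pose proof (carlson_even c n Hc) as H2.
    fold a in H2. set (X := sum_n (fun i => Cmod (c i) ^ 2) n : R) in *.
    set (x := Cmod (c (S n)) ^ 2) in *.
    replace (rho ^ (2 * n + 3)) with (rho ^ (2 * n + 1) * (rho * rho))
      by (rewrite !pow_add; simpl; ring).
    replace (rho ^ (2 * n + 2)) with (rho ^ (2 * n + 1) * rho) by (rewrite !pow_add; simpl; ring).
    assert (Hp : 0 < rho ^ (2 * n + 1)) by (apply pow_lt; lra).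
    set (P := rho ^ (2 * n + 1)) in *.
    assert (H1' : Cmod (c (2 * n + 1)%nat) * P <= (1 - X) * P) by (apply Rmult_le_compat_r; lra).
    assert (H2' : Cmod (c (2 * n + 2)%nat) * (P * rho) <= (1 - X - x / (1 + a)) * (P * rho))
      by (apply Rmult_le_compat_r; nra).
    eapply Rle_trans; [apply Rplus_le_compat_r, Rplus_le_compat; [exact H1'|exact H2']|].
    right. field. lra. }
  induction M as [|M IH].
  - pose proof (Hstep 0%nat) as H. simpl Nat.mul in *. simpl Nat.add in *.
    rewrite Rsum_S, !sum_O. rewrite sum_O in H. fold a in H.
    eapply Rle_trans; [exact H|]. right. rewrite pow_1. unfold Rdiv. ring.
  - replace (2 * S M + 1)%nat with (S (S (2 * M + 1))) by lia.
    rewrite !(Rsum_S _ (S (2 * M + 1))), (Rsum_S _ (2 * M + 1)).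
    rewrite (Rsum_S (fun m => Cmod (c (S m)) ^ 2 * rho ^ (2 * S m)) M).
    pose proof (Hstep (S M)) as H.
    replace (2 * S M + 3)%nat with (2 * M + 5)%nat in H |- * by lia.
    replace (2 * S M + 1)%nat with (2 * M + 3)%nat in H by lia.
    replace (2 * S M + 2)%nat with (2 * M + 4)%nat in H by lia.
    replace (S (S (2 * M + 1))) with (2 * M + 3)%nat by lia.
    replace (S (S (S (2 * M + 1)))) with (2 * M + 4)%nat by lia.
    replace (S (2 * M + 3)) with (2 * M + 4)%nat by lia.
    replace (2 * S (S M))%nat with (2 * M + 4)%nat by lia.
    rewrite Rmult_plus_distr_l. fold a in IH. lra.
Qed.

Lemma refined_bohr (c : nat -> C) (rho : R) :
  contractive c -> 0 < rho < 1 ->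
  ex_series (fun m => Cmod (c (S m)) * rho ^ S m) /\
  ex_series (fun m => Cmod (c (S m)) ^ 2 * rho ^ (2 * S m)) /\
  Series (fun m => Cmod (c (S m)) * rho ^ S m) +
  (1 / (1 + Cmod (c 0%nat)) + rho / (1 - rho)) *
    Series (fun m => Cmod (c (S m)) ^ 2 * rho ^ (2 * S m)) <=
  (1 - Cmod (c 0%nat) ^ 2) * (rho / (1 - rho)).
Proof.
  intros Hc Hrho.
  assert (Hg : ex_series (fun m => rho ^ m)) by (apply ex_series_geom; rewrite Rabs_pos_eq; lra).
  assert (Hle : forall n m, (n <= m)%nat -> rho ^ m <= rho ^ n).
  { intros n m Hnm. replace m with (n + (m - n))%nat by lia. rewrite pow_add.
    rewrite <- (Rmult_1_r (rho ^ n)) at 2. apply Rmult_le_compat_l; [apply pow_le; lra|].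
    apply pow_le_1. lra. }
  assert (Hx : ex_series (fun m => Cmod (c (S m)) * rho ^ S m)).
  { apply (ex_series_le (V := R_CompleteNormedModule)) with (2 := Hg). intros m.
    change (Rabs (Cmod (c (S m)) * rho ^ S m) <= rho ^ m).
    pose proof (Cmod_ge_0 (c (S m))). pose proof (contractive_coef_le_1 c (S m) Hc).
    assert (0 < rho ^ S m) by (apply pow_lt; lra).
    rewrite Rabs_pos_eq by nra. pose proof (Hle m (S m) ltac:(lia)). nra. }
  assert (Hq : ex_series (fun m => Cmod (c (S m)) ^ 2 * rho ^ (2 * S m))).
  { apply (ex_series_le (V := R_CompleteNormedModule)) with (2 := Hg). intros m.
    change (Rabs (Cmod (c (S m)) ^ 2 * rho ^ (2 * S m)) <= rho ^ m).
    pose proof (Cmod_ge_0 (c (S m))). pose proof (contractive_coef_le_1 c (S m) Hc).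
    assert (0 < rho ^ (2 * S m)) by (apply pow_lt; lra).
    assert (0 <= Cmod (c (S m)) ^ 2 <= 1) by nra.
    rewrite Rabs_pos_eq by nra. pose proof (Hle m (2 * S m)%nat ltac:(lia)). nra. }
  split; [exact Hx|]. split; [exact Hq|].
  set (kap := 1 / (1 + Cmod (c 0%nat)) + rho / (1 - rho)).
  assert (L1 : is_lim_seq (fun M => sum_n (fun m => Cmod (c (S m)) * rho ^ S m) (2 * M + 1))
                 (Series (fun m => Cmod (c (S m)) * rho ^ S m))).
  { apply (is_lim_seq_subseq (sum_n (fun m => Cmod (c (S m)) * rho ^ S m)) _ (fun M => (2 * M + 1)%nat)).
    - apply eventually_subseq. intros; lia.
    - exact (Series_correct _ Hx). }
  assert (L2 : is_lim_seq (sum_n (fun m => Cmod (c (S m)) ^ 2 * rho ^ (2 * S m)))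
                 (Series (fun m => Cmod (c (S m)) ^ 2 * rho ^ (2 * S m))))
    by exact (Series_correct _ Hq).
  assert (L3 := is_lim_seq_plus' _ _ _ _ L1 (is_lim_seq_scal_l _ kap _ L2)).
  refine (is_lim_seq_le _ _ (Finite _) (Finite _) _ L3 (is_lim_seq_const _)).
  intros M. eapply Rle_trans; [exact (refined_bohr_partial c rho M Hc Hrho)|].
  enough (0 <= rho ^ (2 * M + 3) / (1 - rho) * (1 - sum_n (fun i => Cmod (c i) ^ 2) (S M))) by lra.
  apply Rmult_le_pos.
  - apply Rmult_le_pos; [apply pow_le; lra|]. left. apply Rinv_0_lt_compat. lra.
  - generalize (carlson_odd c (S M) Hc) (Cmod_ge_0 (c (2 * S M + 1)%nat)). lra.
Qed.

(** * The radius *)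

(** The equation of the radius multiplied by [x], which makes all exponents
    natural numbers, also for [k = 0].  Since
    [5 x^2 - 2 x + 1 = 4 x^2 + (1 - x)^2], its sign compares [x^k (t + 1/(4t))]
    with 1, where [t = x/(1-x)]. *)
Definition radius_fun (k : nat) (x : R) : R :=
  x ^ k * (5 * x ^ 2 - 2 * x + 1) - 4 * x * (1 - x).

Lemma radius_root_iff (k : nat) (x : R) :
  radius_root k x <-> 0 < x < 1 /\ radius_fun k x = 0.
Proof.
  unfold radius_root.
  assert (H : 0 < x < 1 -> radius_fun k x =
    x * (5 * x ^ (k + 1) - 2 * x ^ k + powerRZ x (Z.of_nat k - 1) + 4 * x - 4)).
  { intros Hx. unfold radius_fun. rewrite pow_add. destruct k as [|k].
    - simpl. field. lra.
    - replace (Z.of_nat (S k) - 1)%Z with (Z.of_nat k) by lia.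
      rewrite <- pow_powerRZ. simpl. ring. }
  split; intros [Hx E]; (split; [exact Hx|]); specialize (H Hx).
  - rewrite H, E. ring.
  - rewrite E in H. apply eq_sym, Rmult_integral in H. destruct H; [lra|assumption].
Qed.

(** [x^k] is nondecreasing, and [t + 1/(4t)] increases for [t >= 1/2], that is
    for [x >= 1/3]; the second fact is the inequality [Hw] between cross
    products. *)
Lemma radius_fun_increasing_sign (k : nat) (x y : R) :
  1 / 3 <= x -> x < y < 1 -> 0 <= radius_fun k x -> 0 < radius_fun k y.
Proof.
  unfold radius_fun. intros Hx Hy H.
  assert (Hp : 0 < x ^ k) by (apply pow_lt; lra).
  assert (Hq : x ^ k <= y ^ k) by (apply pow_incr; lra).
  assert (Hw : 0 < (5 * y ^ 2 - 2 * y + 1) * (x * (1 - x)) - (5 * x ^ 2 - 2 * x + 1) * (y * (1 - y))).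
  { replace (_ - _) with ((y - x) * (3 * (x * y) + x + y - 1)) by ring.
    apply Rmult_lt_0_compat; [lra|]. nra. }
  assert (Hy1 : 0 < y * (1 - y)) by nra.
  assert (Hx1 : 0 < x * (1 - x)) by nra.
  assert (HA : 0 < 5 * y ^ 2 - 2 * y + 1) by nra.
  apply Rmult_lt_reg_r with (x * (1 - x)); [exact Hx1|]. rewrite Rmult_0_l.
  set (Ay := 5 * y ^ 2 - 2 * y + 1) in *. set (Ax := 5 * x ^ 2 - 2 * x + 1) in *.
  set (Bx := x * (1 - x)) in *. set (By := y * (1 - y)) in *.
  replace (4 * y * (1 - y)) with (4 * By) by (unfold By; ring).
  replace (4 * x * (1 - x)) with (4 * Bx) in H by (unfold Bx; ring).
  assert (H1 : x ^ k * (Ay * Bx) <= y ^ k * (Ay * Bx)) by (apply Rmult_le_compat_r; nra).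
  assert (H2 : x ^ k * (Ax * By) < x ^ k * (Ay * Bx)) by (apply Rmult_lt_compat_l; lra).
  assert (H3 : 0 <= (x ^ k * Ax - 4 * Bx) * By) by (apply Rmult_le_pos; lra).
  nra.
Qed.

(** For [k = 0] the function is [(3x - 1)^2]; for [k > 0] it is negative. *)
Lemma radius_fun_below_third (k : nat) (x : R) :
  0 < x < 1 / 3 -> radius_fun k x <> 0.
Proof.
  unfold radius_fun. intros Hx. destruct k as [|k]; simpl.
  - nra.
  - assert (0 < x ^ k <= 1).
    { split; [apply pow_lt; lra|]. apply pow_le_1. lra. }
    replace (x * x ^ k * (5 * (x * (x * 1)) - 2 * x + 1) - 4 * x * (1 - x)) with
      (x * (x ^ k * (5 * (x * x) - 2 * x + 1) - 4 * (1 - x))) by ring.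
    assert (HA : 0 <= 5 * (x * x) - 2 * x + 1 < 4 * (1 - x)) by nra.
    assert (Hlt : x ^ k * (5 * (x * x) - 2 * x + 1) - 4 * (1 - x) < 0)
      by (generalize (Rmult_le_compat_r _ (x ^ k) 1 (proj1 HA)); lra).
    generalize (Rmult_lt_compat_l x _ 0 (proj1 Hx) Hlt). lra.
Qed.

Lemma radius_exists (k : nat) :
  exists x, 1 / 3 <= x < 1 /\ radius_fun k x = 0.
Proof.
  destruct (IVT_cor (radius_fun k) (1 / 3) 1) as (x & Hx & E).
  - unfold radius_fun. intros x. reg.
  - lra.
  - assert (Hp : 0 < (1 / 3) ^ k <= 1).
    { split; [apply pow_lt; lra|]. apply pow_le_1. lra. }
    unfold radius_fun. rewrite !pow1. set (p := (1 / 3) ^ k) in *.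
    replace (_ * _) with (32 / 9 * (p - 1)) by field. lra.
  - exists x. split; [|exact E]. split; [lra|].
    destruct (Req_dec x 1) as [->|]; [|lra].
    unfold radius_fun in E. rewrite !pow1 in E. lra.
Qed.

Lemma radius_unique (k : nat) (x : R) :
  1 / 3 <= x < 1 -> radius_fun k x = 0 -> unique (radius_root k) x.
Proof.
  intros Hx E. split; [apply radius_root_iff; split; [lra|exact E]|].
  intros y Hy. apply radius_root_iff in Hy. destruct Hy as [Hy Ey].
  destruct (Rlt_or_le y (1 / 3)) as [Hy3|Hy3].
  - exfalso. apply (radius_fun_below_third k y); [lra|exact Ey].
  - destruct (Rtotal_order x y) as [H|[H|H]]; [|exact H|]; exfalso.
    + generalize (radius_fun_increasing_sign k x y). lra.
    + generalize (radius_fun_increasing_sign k y x). lra.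
Qed.

(** As a function of [a] the majorant is a concave parabola with vertex
    [1/(2t)], [t = rho/(1-rho)].  For [t <= 1/2] its maximum over [0,1] is at
    [a = 1]; for larger [t] it is the vertex value [t + 1/(4t)], which the
    radius equation compares with 1. *)
Lemma bohr_majorant_le_1 (k : nat) (rk rho a : R) :
  1 / 3 <= rk < 1 -> radius_fun k rk = 0 -> 0 < rho <= rk -> 0 <= a <= 1 ->
  rho ^ k * (a + (1 - a ^ 2) * (rho / (1 - rho))) <= 1.
Proof.
  intros Hrk E Hrho Ha.
  replace (a + (1 - a ^ 2) * (rho / (1 - rho))) with
    ((a * (1 - rho) + (1 - a ^ 2) * rho) / (1 - rho)) by (field; lra).
  unfold Rdiv. rewrite <- Rmult_assoc. apply Rmult_le_reg_r with (1 - rho); [lra|].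
  rewrite Rmult_assoc, Rinv_l, Rmult_1_r, Rmult_1_l by lra.
  assert (Hp : 0 < rho ^ k <= 1).
  { split; [apply pow_lt; lra|]. apply pow_le_1. lra. }
  destruct (Rle_or_lt rho (1 / 3)) as [H3|H3].
  - assert (0 <= a * (1 - rho) + (1 - a ^ 2) * rho <= 1 - rho).
    { split.
      - assert (0 <= (1 - a ^ 2) * rho) by (apply Rmult_le_pos; nra). nra.
      - replace (1 - rho) with (a * (1 - rho) + (1 - a ^ 2) * rho +
          (1 - a) * ((1 - rho) - (1 + a) * rho)) at 2 by ring.
        assert (0 <= (1 - a) * ((1 - rho) - (1 + a) * rho)) by (apply Rmult_le_pos; nra). lra. }
    nra.
  - assert (HF : radius_fun k rho <= 0).
    { destruct (Rle_or_lt (radius_fun k rho) 0) as [|Hpos]; [assumption|].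
      destruct (Req_dec rho rk) as [->|Hne]; [lra|].
      generalize (radius_fun_increasing_sign k rho rk). lra. }
    unfold radius_fun in HF.
    assert (Hsq : 4 * rho * (a * (1 - rho) + (1 - a ^ 2) * rho) <= 5 * rho ^ 2 - 2 * rho + 1).
    { pose proof (pow2_ge_0 (2 * a * rho - (1 - rho))). lra. }
    apply Rmult_le_reg_l with (4 * rho); [lra|].
    assert (rho ^ k * (4 * rho * (a * (1 - rho) + (1 - a ^ 2) * rho)) <=
            rho ^ k * (5 * rho ^ 2 - 2 * rho + 1))
      by (apply Rmult_le_compat_l; lra).
    lra.
Qed.

(** The witness is the vertex [1/(2t)] of the parabola, which is below 1
    because [rho > 1/3]. *)
Lemma bohr_majorant_gt_1 (k : nat) (rk rho : R) :
  1 / 3 <= rk < 1 -> radius_fun k rk = 0 -> rk < rho < 1 ->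
  exists a, 0 < a < 1 /\ 1 < rho ^ k * (a + (1 - a ^ 2) * (rho / (1 - rho))).
Proof.
  intros Hrk E Hrho. exists ((1 - rho) / (2 * rho)).
  split.
  - split; [apply Rdiv_lt_0_compat; lra|]. apply (Rdiv_lt_1 (1 - rho) (2 * rho)); lra.
  - assert (HF : 0 < radius_fun k rho) by (apply (radius_fun_increasing_sign k rk); lra).
    unfold radius_fun in HF.
    replace ((1 - rho) / (2 * rho) + (1 - ((1 - rho) / (2 * rho)) ^ 2) * (rho / (1 - rho))) with
      ((5 * rho ^ 2 - 2 * rho + 1) / (4 * rho * (1 - rho))) by (field; lra).
    set (B := 4 * rho * (1 - rho)) in *.
    assert (HB : 0 < B) by (unfold B; nra).
    apply Rmult_lt_reg_r with B; [exact HB|].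
    unfold Rdiv. rewrite <- Rmult_assoc, (Rmult_assoc _ (/ B) B), Rinv_l by lra. lra.
Qed.

(** * Transfer to the unit disk *)

(** In the coordinate of the unit disk the powers of [1 - gamma] disappear, and
    the factor [w^k] contributes [rho^k] to both sums: to the second one
    because the exponent there is [2n - k]. *)
Lemma bohr_lhs_rescale (gamma : R) (k : nat) (a c : nat -> C) (rho : R) :
  0 <= gamma < 1 -> 0 < rho < 1 ->
  (forall m, Cmod (a (k + m)%nat) = (1 - gamma) ^ (k + m) * Cmod (c m)) ->
  ex_series (fun m => Cmod (c (S m)) * rho ^ S m) ->
  ex_series (fun m => Cmod (c (S m)) ^ 2 * rho ^ (2 * S m)) ->
  bohr_sums_converge gamma k a rho /\
  bohr_lhs gamma k a rho = rho ^ k *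
    (Cmod (c 0%nat) + (Series (fun m => Cmod (c (S m)) * rho ^ S m) +
      (1 / (1 + Cmod (c 0%nat)) + rho / (1 - rho)) *
      Series (fun m => Cmod (c (S m)) ^ 2 * rho ^ (2 * S m)))).
Proof.
  intros Hg Hrho Hac Hx Hq.
  assert (Hpow : forall n, 0 < (1 - gamma) ^ n) by (intros; apply pow_lt; lra).
  assert (El : forall m, rho ^ k * (Cmod (c m) * rho ^ m) = lin_term gamma a rho (k + m)).
  { intros m. unfold lin_term. rewrite Hac, (pow_add rho). field.
    specialize (Hpow (k + m)%nat). lra. }
  assert (Es : forall m, rho ^ k * (Cmod (c (S m)) ^ 2 * rho ^ (2 * S m)) =
                         sq_term gamma k a rho (k + 1 + m)).
  { intros m. unfold sq_term. replace (k + 1 + m)%nat with (k + S m)%nat by lia.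
    rewrite Hac. replace (2 * (k + S m) - k)%nat with (k + 2 * S m)%nat by lia.
    rewrite (pow_add rho), (Nat.mul_comm 2 (k + S m)), (pow_mult _ (k + S m) 2). field.
    specialize (Hpow (k + S m)%nat). lra. }
  assert (Hx0 : ex_series (fun m => Cmod (c m) * rho ^ m)).
  { apply ex_series_incr_1. exact Hx. }
  assert (Hc : bohr_sums_converge gamma k a rho).
  { split.
    - apply (ex_series_ext _ _ El).
      exact (ex_series_scal_l (K := R_AbsRing) (V := R_NormedModule) (rho ^ k) _ Hx0).
    - apply (ex_series_ext _ _ Es).
      exact (ex_series_scal_l (K := R_AbsRing) (V := R_NormedModule) (rho ^ k) _ Hq). }
  split; [exact Hc|].
  unfold bohr_lhs, Series_from.
  rewrite <- (Series_ext _ _ El), <- (Series_ext _ _ Es), !Series_scal_l, (Series_incr_1 _ Hx0).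
  replace (Cmod (a k)) with ((1 - gamma) ^ k * Cmod (c 0%nat))
    by (rewrite <- (Nat.add_0_r k) at 1; now rewrite <- Hac, Nat.add_0_r).
  pose proof (Cmod_ge_0 (c 0%nat)). specialize (Hpow k).
  replace ((1 - gamma) ^ k / ((1 - gamma) ^ k + (1 - gamma) ^ k * Cmod (c 0%nat))) with
    (1 / (1 + Cmod (c 0%nat))).
  - simpl (rho ^ 0). ring.
  - field. split; nra.
Qed.

Lemma disk_coordinate (gamma : R) (z : C) :
  0 <= gamma < 1 -> Omega gamma z ->
  Cmod (RtoC (1 - gamma) * (z + RtoC (gamma / (1 - gamma))))%C < 1.
Proof.
  unfold Omega. intros Hg Hz. rewrite Cmod_mult, Cmod_R, Rabs_pos_eq by lra.
  apply Rmult_lt_compat_l with (r := 1 - gamma) in Hz; [|lra].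
  replace ((1 - gamma) * (1 / (1 - gamma))) with 1 in Hz by (field; lra). exact Hz.
Qed.

Lemma bohr_upper_bound (gamma : R) (k : nat) (f : C -> C) (a : nat -> C) (rho : R) :
  0 <= gamma < 1 -> 0 < rho < 1 ->
  class_B (Omega gamma) f -> has_expansion gamma k a f ->
  exists A, 0 <= A <= 1 /\ bohr_sums_converge gamma k a rho /\
    bohr_lhs gamma k a rho <= rho ^ k * (A + (1 - A ^ 2) * (rho / (1 - rho))).
Proof.
  intros Hg Hrho [_ Hf] Ha.
  set (G := RtoC (1 - gamma)).
  assert (HG : G <> 0%C) by (intros E; injection E; lra).
  assert (HGn : forall n, (G ^ n)%C <> 0%C) by (intros; now apply Cpow_nz).
  assert (HGm : forall n, Cmod (G ^ n)%C = (1 - gamma) ^ n).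
  { intros n. rewrite Cmod_pow. unfold G. rewrite Cmod_R, Rabs_pos_eq; lra. }
  set (c := fun m => (a (k + m)%nat / G ^ (k + m))%C).
  set (zw := fun w : C => (w / G - RtoC (gamma / (1 - gamma)))%C).
  assert (Hc : contractive c).
  { intros p J L Hp. apply (conv_norm_le c p (fun w => f (zw w) / w ^ k)%C k J L); [|exact Hp].
    intros w Hw.
    assert (Hw0 : w <> 0%C) by (apply Cmod_gt_0; lra).
    assert (Hwk : (w ^ k)%C <> 0%C) by now apply Cpow_nz.
    assert (Ezw : (zw w + RtoC (gamma / (1 - gamma)) = w / G)%C) by (unfold zw; ring).
    assert (HO : Omega gamma (zw w)).
    { unfold Omega. rewrite Ezw, Cmod_div by exact HG. unfold G.
      rewrite Cmod_R, Rabs_pos_eq by lra. unfold Rdiv.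
      apply Rmult_lt_compat_r; [apply Rinv_0_lt_compat|]; lra. }
    split.
    - specialize (Ha (zw w) HO). rewrite Ezw in Ha.
      apply (is_series_scal (K := C_AbsRing) (V := C_NormedModule) (/ w ^ k)%C) in Ha.
      replace (f (zw w) / w ^ k)%C with (scal (/ w ^ k)%C (f (zw w)))
        by (change (/ w ^ k * f (zw w) = f (zw w) / w ^ k)%C; unfold Cdiv; ring).
      refine (is_series_ext _ _ _ _ Ha). intros m.
      change (/ w ^ k * (a (k + m)%nat * (w / G) ^ (k + m)) = a (k + m)%nat / G ^ (k + m) * w ^ m)%C.
      unfold Cdiv at 1. rewrite Cpow_mult_l, Cpow_inv by exact HG. rewrite (Cpow_add_r w).
      field. split; [apply HGn|exact Hwk].
    - replace (w ^ k * (f (zw w) / w ^ k))%C with (f (zw w)) by (field; exact Hwk).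
      now apply Hf. }
  exists (Cmod (c 0%nat)).
  destruct (refined_bohr c rho Hc Hrho) as (Hx & Hq & Hb).
  destruct (bohr_lhs_rescale gamma k a c rho Hg Hrho) as [Hconv E]; [|exact Hx|exact Hq|].
  { intros m. unfold c. rewrite Cmod_div, HGm by apply HGn. field.
    apply Rgt_not_eq, pow_lt. lra. }
  split; [split; [apply Cmod_ge_0|now apply contractive_coef_le_1]|].
  split; [exact Hconv|]. rewrite E.
  apply Rmult_le_compat_l; [apply pow_le; lra|]. lra.
Qed.

(** * Extremal functions *)

Lemma is_Cseries_geom (q : C) : Cmod q < 1 -> is_Cseries (fun m => q ^ m)%C (/ (1 - q))%C.
Proof.
  intros Hq.
  assert (Hq1 : (1 - q)%C <> 0%C).
  { intros E. assert (q = 1%C) by (replace q with (1 - (1 - q))%C by ring; rewrite E; ring).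
    subst q. rewrite Cmod_1 in Hq. lra. }
  assert (Hm : 0 < Cmod (1 - q)%C) by now apply Cmod_gt_0.
  apply (proj2 (filterlim_locally_ball_norm (U := C_NormedModule) _ _)). intros eps.
  assert (Hl : is_lim_seq (fun n => Cmod q ^ n) 0).
  { apply is_lim_seq_geom. rewrite Rabs_pos_eq; [exact Hq|apply Cmod_ge_0]. }
  apply is_lim_seq_incr_1, is_lim_seq_spec in Hl.
  assert (He : 0 < eps * Cmod (1 - q)%C) by (apply Rmult_lt_0_compat; [apply cond_pos|exact Hm]).
  destruct (Hl (mkposreal _ He)) as [n0 Hn0]. exists n0. intros n Hn. specialize (Hn0 n Hn).
  change (Cmod (sum_n (fun m => q ^ m)%C n - / (1 - q))%C < eps).
  simpl in Hn0. rewrite Rminus_0_r, Rabs_pos_eq in Hn0.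
  2: { apply Rmult_le_pos; [apply Cmod_ge_0|apply pow_le, Cmod_ge_0]. }
  replace (sum_n (fun m => q ^ m)%C n - / (1 - q))%C with
    ((((1 - q) * sum_n (fun m => q ^ m)%C n) - 1) / (1 - q))%C
    by (change (@eq C (((1 - q) * sum_n (fun m => q ^ m)%C n - 1) / (1 - q))
          (sum_n (fun m => q ^ m)%C n - / (1 - q)))%C; field; exact Hq1).
  rewrite sum_geom, Cmod_div by exact Hq1.
  replace (1 - q ^ S n - 1)%C with (- q ^ S n)%C by ring.
  rewrite Cmod_opp, Cmod_pow. apply Rmult_lt_reg_r with (Cmod (1 - q)%C); [exact Hm|].
  unfold Rdiv. rewrite Rmult_assoc, Rinv_l by lra. simpl. lra.
Qed.

(** The disk automorphism with value [al] at 0. *)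
Definition blaschke (al : R) (w : C) : C := ((RtoC al - w) / (1 - RtoC al * w))%C.

Definition blaschke_coef (al : R) (m : nat) : C :=
  match m with O => RtoC al | S i => RtoC (- (1 - al ^ 2) * al ^ i) end.

Lemma blaschke_denominator (al : R) (w : C) :
  0 < al < 1 -> Cmod w < 1 -> (1 - RtoC al * w)%C <> 0%C.
Proof.
  intros Hal Hw E.
  assert (E1 : (RtoC al * w = 1)%C)
    by (replace (RtoC al * w)%C with (1 - (1 - RtoC al * w))%C by ring; rewrite E; ring).
  apply (f_equal Cmod) in E1. rewrite Cmod_mult, Cmod_1, Cmod_R, Rabs_pos_eq in E1 by lra.
  pose proof (Cmod_ge_0 w). nra.
Qed.

Lemma blaschke_expansion (al : R) (w : C) :
  0 < al < 1 -> Cmod w < 1 ->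
  is_Cseries (fun m => blaschke_coef al m * w ^ m)%C (blaschke al w).
Proof.
  intros Hal Hw. pose proof (blaschke_denominator al w Hal Hw) as Hd.
  assert (Hq : Cmod (RtoC al * w)%C < 1).
  { rewrite Cmod_mult, Cmod_R, Rabs_pos_eq by lra. pose proof (Cmod_ge_0 w). nra. }
  apply is_series_decr_1.
  pose proof (is_series_scal (K := C_AbsRing) (V := C_NormedModule)
    (RtoC (- (1 - al ^ 2)) * w)%C _ _ (is_Cseries_geom _ Hq)) as H.
  replace (plus _ _) with (scal (RtoC (- (1 - al ^ 2)) * w)%C (/ (1 - RtoC al * w))%C).
  - refine (is_series_ext _ _ _ _ H). intros m.
    change ((RtoC (- (1 - al ^ 2)) * w) * (RtoC al * w) ^ m =
            RtoC (- (1 - al ^ 2) * al ^ m) * w ^ S m)%C.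
    rewrite Cpow_mult_l, RtoC_mult, RtoC_pow, Cpow_S. ring.
  - change ((RtoC (- (1 - al ^ 2)) * w) * / (1 - RtoC al * w) =
            (RtoC al - w) / (1 - RtoC al * w) + - (RtoC al * 1))%C.
    rewrite RtoC_opp, RtoC_minus, RtoC_pow. field. exact Hd.
Qed.

Lemma blaschke_le_1 (al : R) (w : C) :
  0 < al < 1 -> Cmod w < 1 -> Cmod (blaschke al w) <= 1.
Proof.
  intros Hal Hw. pose proof (blaschke_denominator al w Hal Hw) as Hd.
  unfold blaschke. rewrite Cmod_div by exact Hd.
  assert (Hm : 0 < Cmod (1 - RtoC al * w)%C) by now apply Cmod_gt_0.
  apply Rmult_le_reg_r with (Cmod (1 - RtoC al * w)%C); [exact Hm|].
  unfold Rdiv. rewrite Rmult_assoc, Rinv_l, Rmult_1_r, Rmult_1_l by lra.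
  apply Rsqr_incr_0; [|apply Cmod_ge_0|lra].
  rewrite !Rsqr_pow2, !Cmod2_alt.
  assert (Hw2 : Re w ^ 2 + Im w ^ 2 <= 1).
  { rewrite <- Cmod2_alt. pose proof (Cmod_ge_0 w). nra. }
  destruct w as [u v]. unfold Re, Im in *. simpl in *.
  assert (0 <= (1 - al * al) * (1 - (u * u + v * v))) by (apply Rmult_le_pos; nra).
  nra.
Qed.

Notation C_regular := (AbsRing_NormedModule C_AbsRing).

(** Quadratic estimate: the remainder is [(y - x)^2 / (x^2 y)], and [d] keeps
    [|y|] above [|x|/2]. *)
Lemma is_derive_Cinv (x : C) :
  x <> 0%C -> is_derive (K := C_AbsRing) (V := C_regular) Cinv x (- / (x * x))%C.
Proof.
  intros Hx. assert (Hm : 0 < Cmod x) by now apply Cmod_gt_0.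
  split; [apply is_linear_scal_l|].
  intros x' Hx'. rewrite <- (is_filter_lim_locally_unique _ _ Hx'). clear x' Hx'.
  intros eps.
  set (d := Rmin (Cmod x / 2) (eps * Cmod x ^ 3 / 2)).
  assert (Hm3 : 0 < eps * Cmod x ^ 3).
  { apply Rmult_lt_0_compat; [apply cond_pos|apply pow_lt; exact Hm]. }
  assert (Hd : 0 < d) by (unfold d; apply Rmin_pos; lra).
  enough (Hest : forall y : C, Cmod (y - x)%C < d ->
    Cmod ((/ y - / x) - (y - x) * (- / (x * x)))%C <= eps * Cmod (y - x)%C)
    by (exists (mkposreal d Hd); exact Hest).
  intros y Hy.
  assert (Hd1 : d <= Cmod x / 2) by apply Rmin_l.
  assert (Hd2 : d <= eps * Cmod x ^ 3 / 2) by apply Rmin_r.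
  assert (Hy2 : Cmod x / 2 <= Cmod y).
  { pose proof (Cmod_triangle (x - y) y) as T. replace (x - y + y)%C with x in T by ring.
    replace (x - y)%C with (- (y - x))%C in T by ring. rewrite Cmod_opp in T. lra. }
  assert (Hy0 : y <> 0%C) by (apply Cmod_gt_0; lra).
  replace (/ y - / x - (y - x) * - / (x * x))%C with ((y - x) * ((y - x) / (x * x * y)))%C
    by (field; split; assumption).
  rewrite Cmod_mult, Rmult_comm. apply Rmult_le_compat_r; [apply Cmod_ge_0|].
  assert (Hxxy : (x * x * y)%C <> 0%C).
  { apply Cmod_gt_0. rewrite !Cmod_mult. apply Rmult_lt_0_compat; [nra|lra]. }
  rewrite Cmod_div by exact Hxxy. rewrite !Cmod_mult.
  set (X := Cmod x) in *. set (Y := Cmod y) in *.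
  assert (HXY : 0 < X * X * Y) by (apply Rmult_lt_0_compat; nra).
  apply Rmult_le_reg_r with (X * X * Y); [exact HXY|].
  unfold Rdiv. rewrite Rmult_assoc, Rinv_l, Rmult_1_r by lra.
  apply Rle_trans with (eps * X ^ 3 / 2); [lra|].
  replace (eps * X ^ 3 / 2) with (eps * (X * X * (X / 2))) by field.
  apply Rmult_le_compat_l; [left; apply cond_pos|]. apply Rmult_le_compat_l; [nra|exact Hy2].
Qed.

Definition extremal (gamma : R) (k : nat) (al : R) (z : C) : C :=
  let w := (RtoC (1 - gamma) * (z + RtoC (gamma / (1 - gamma))))%C in
  (w ^ k * blaschke al w)%C.

Definition extremal_coef (gamma : R) (k : nat) (al : R) (n : nat) : C :=
  (RtoC (1 - gamma) ^ n * blaschke_coef al (n - k))%C.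

Lemma ex_derive_pow_blaschke (k : nat) (al : R) (w : C) :
  0 < al < 1 -> Cmod w < 1 ->
  ex_derive (K := C_AbsRing) (V := C_regular) (fun w => w ^ k * blaschke al w)%C w.
Proof.
  intros Hal Hw. pose proof (blaschke_denominator al w Hal Hw) as Hd.
  assert (Hmul : forall f g : C -> C,
    ex_derive (K := C_AbsRing) (V := C_regular) f w ->
    ex_derive (K := C_AbsRing) (V := C_regular) g w ->
    ex_derive (K := C_AbsRing) (V := C_regular) (fun x => f x * g x)%C w).
  { intros f g [df Hf] [dg Hg]. eexists.
    exact (is_derive_mult (K := C_AbsRing) f g w df dg Hf Hg Cmult_comm). }
  assert (Hid : ex_derive (K := C_AbsRing) (V := C_regular) (fun x => x) w)
    by exact (ex_derive_id (K := C_AbsRing) w).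
  assert (Hcst : forall x : C, ex_derive (K := C_AbsRing) (V := C_regular) (fun _ => x) w)
    by (intros x; exact (ex_derive_const (K := C_AbsRing) (V := C_regular) x w)).
  apply Hmul.
  - induction k as [|k IH]; [exact (Hcst 1%C)|].
    apply (ex_derive_ext (K := C_AbsRing) (V := C_regular) (fun x => x * x ^ k)%C); [reflexivity|].
    now apply Hmul.
  - apply Hmul.
    + exact (ex_derive_minus (K := C_AbsRing) (V := C_regular) _ _ w (Hcst (RtoC al)) Hid).
    + assert (Hden : ex_derive (K := C_AbsRing) (V := C_regular) (fun x => 1 - RtoC al * x)%C w).
      { apply (ex_derive_minus (K := C_AbsRing) (V := C_regular) _ _ w (Hcst 1%C)).
        apply (Hmul (fun _ => RtoC al)); [apply Hcst|exact Hid]. }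
      destruct Hden as [d Hden]. eexists.
      exact (is_derive_comp (K := C_AbsRing) (V := C_regular) Cinv
        (fun x => 1 - RtoC al * x)%C w _ d (is_derive_Cinv _ Hd) Hden).
Qed.

(** [C] carries two normed module structures over itself, with the same norm
    but different balls; derivatives are computed in the one that makes [C] the
    regular module of its scalars, and analyticity is stated in the other. *)
Lemma is_derive_C_NormedModule (f : C -> C) (x l : C) :
  is_derive (K := C_AbsRing) (V := C_regular) f x l ->
  is_derive (K := C_AbsRing) (V := C_NormedModule) f x l.
Proof.
  intros [[H1 H2 H3] Hd]. split; [|exact Hd].
  split; [exact H1|exact H2|exact H3].
Qed.

Lemma extremal_class_B (gamma : R) (k : nat) (al : R) :
  0 <= gamma < 1 -> 0 < al < 1 -> class_B (Omega gamma) (extremal gamma k al).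
Proof.
  intros Hg Hal. split; intros z Hz; pose proof (disk_coordinate gamma z Hg Hz) as Hw.
  - destruct (ex_derive_pow_blaschke k al _ Hal Hw) as [d Hd]. eexists.
    apply is_derive_C_NormedModule.
    refine (is_derive_comp (K := C_AbsRing) (V := C_regular) _
      (fun z => RtoC (1 - gamma) * (z + RtoC (gamma / (1 - gamma))))%C z d _ Hd _).
    apply (is_derive_mult (K := C_AbsRing) (fun _ => RtoC (1 - gamma))
      (fun z => z + RtoC (gamma / (1 - gamma)))%C).
    + exact (is_derive_const (K := C_AbsRing) (V := C_regular) (RtoC (1 - gamma)) z).
    + apply (is_derive_plus (K := C_AbsRing) (V := C_regular) (fun z => z)
        (fun _ => RtoC (gamma / (1 - gamma)))).
      * exact (is_derive_id (K := C_AbsRing) z).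
      * exact (is_derive_const (K := C_AbsRing) (V := C_regular) (RtoC (gamma / (1 - gamma))) z).
    + exact Cmult_comm.
  - unfold extremal. rewrite Cmod_mult, Cmod_pow.
    set (w := (RtoC (1 - gamma) * _)%C) in *.
    pose proof (Cmod_ge_0 w) as Hw0.
    assert (0 <= Cmod w ^ k <= 1) by (split; [now apply pow_le|apply pow_le_1; lra]).
    pose proof (blaschke_le_1 al w Hal Hw). pose proof (Cmod_ge_0 (blaschke al w)). nra.
Qed.

Lemma extremal_expansion (gamma : R) (k : nat) (al : R) :
  0 <= gamma < 1 -> 0 < al < 1 ->
  has_expansion gamma k (extremal_coef gamma k al) (extremal gamma k al).
Proof.
  intros Hg Hal z Hz. pose proof (disk_coordinate gamma z Hg Hz) as Hw.
  unfold extremal. set (w := (RtoC (1 - gamma) * _)%C) in *.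
  pose proof (is_series_scal (K := C_AbsRing) (V := C_NormedModule) (w ^ k)%C _ _
    (blaschke_expansion al w Hal Hw)) as H.
  refine (is_series_ext _ _ _ _ H). intros m.
  change (w ^ k * (blaschke_coef al m * w ^ m) = extremal_coef gamma k al (k + m) *
    (z + RtoC (gamma / (1 - gamma))) ^ (k + m))%C.
  unfold extremal_coef. replace (k + m - k)%nat with m by lia.
  transitivity (blaschke_coef al m * w ^ (k + m))%C; [rewrite Cpow_add_r; ring|].
  unfold w. rewrite Cpow_mult_l. ring.
Qed.

(** For a disk automorphism all of Carlson's losses are exact: both sums are
    geometric, and they add up to the upper bound of [refined_bohr]. *)
Lemma extremal_bohr (gamma : R) (k : nat) (al rho : R) :
  0 <= gamma < 1 -> 0 < al < 1 -> 0 < rho < 1 ->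
  bohr_sums_converge gamma k (extremal_coef gamma k al) rho /\
  bohr_lhs gamma k (extremal_coef gamma k al) rho =
  rho ^ k * (al + (1 - al ^ 2) * (rho / (1 - rho))).
Proof.
  intros Hg Hal Hrho. set (c := blaschke_coef al).
  assert (Hcm : forall m, Cmod (c (S m)) = (1 - al ^ 2) * al ^ m).
  { intros m. simpl c. unfold c, blaschke_coef. rewrite Cmod_R, Rabs_mult, Rabs_Ropp, !Rabs_pos_eq;
      [reflexivity| |].
    - apply pow_le. lra.
    - nra. }
  assert (Har : 0 < al * rho < 1) by nra.
  assert (Hr1 : Rabs (al * rho) < 1) by (rewrite Rabs_pos_eq; lra).
  assert (Hr2 : Rabs ((al * rho) ^ 2) < 1).
  { rewrite Rabs_pos_eq by apply pow2_ge_0. nra. }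
  assert (Hx : is_series (fun m => Cmod (c (S m)) * rho ^ S m)
                 ((1 - al ^ 2) * rho * / (1 - al * rho))).
  { refine (is_series_ext _ _ _ _ (is_series_scal (K := R_AbsRing) (V := R_NormedModule)
      ((1 - al ^ 2) * rho) _ _ (is_series_geom _ Hr1))).
    intros m. change ((1 - al ^ 2) * rho * (al * rho) ^ m = Cmod (c (S m)) * rho ^ S m).
    rewrite Hcm, Rpow_mult_distr. simpl. ring. }
  assert (Hq : is_series (fun m => Cmod (c (S m)) ^ 2 * rho ^ (2 * S m))
                 (((1 - al ^ 2) * rho) ^ 2 * / (1 - (al * rho) ^ 2))).
  { refine (is_series_ext _ _ _ _ (is_series_scal (K := R_AbsRing) (V := R_NormedModule)
      (((1 - al ^ 2) * rho) ^ 2) _ _ (is_series_geom _ Hr2))).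
    intros m. change (((1 - al ^ 2) * rho) ^ 2 * ((al * rho) ^ 2) ^ m = Cmod (c (S m)) ^ 2 * rho ^ (2 * S m)).
    rewrite Hcm, (pow_mult rho 2 (S m)), !Rpow_mult_distr.
    replace ((al ^ 2) ^ m) with ((al ^ m) ^ 2)
      by (rewrite <- !pow_mult; f_equal; apply Nat.mul_comm).
    simpl. ring. }
  destruct (bohr_lhs_rescale gamma k (extremal_coef gamma k al) c rho Hg Hrho) as [Hconv E].
  - intros m. unfold extremal_coef. replace (k + m - k)%nat with m by lia.
    rewrite Cmod_mult, Cmod_pow, Cmod_R, Rabs_pos_eq by lra. reflexivity.
  - eexists; exact Hx.
  - eexists; exact Hq.
  - split; [exact Hconv|]. rewrite E, (is_series_unique _ _ Hx), (is_series_unique _ _ Hq).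
    replace (Cmod (c 0%nat)) with al by (simpl; rewrite Cmod_R, Rabs_pos_eq; lra).
    f_equal. f_equal. field.
    repeat split; nra.
Qed.

Theorem theorem3p1 (gamma : R) (hgamma : 0 <= gamma < 1) (k : nat) :
  exists rho_k : R,
    unique (radius_root k) rho_k /\
    (forall (f : C -> C) (a : nat -> C),
       class_B (Omega gamma) f ->
       has_expansion gamma k a f ->
       forall rho : R, 0 < rho < 1 -> rho <= rho_k ->
         bohr_sums_converge gamma k a rho /\ bohr_lhs gamma k a rho <= 1) /\
    (forall rho : R, rho_k < rho < 1 ->
       exists (f : C -> C) (a : nat -> C),
         class_B (Omega gamma) f /\
         has_expansion gamma k a f /\
         bohr_sums_converge gamma k a rho /\ 1 < bohr_lhs gamma k a rho).
Proof.
  destruct (radius_exists k) as (rk & Hrk & E). exists rk.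
  split; [now apply radius_unique|]. split.
  - intros f a Hf Ha rho Hrho Hle.
    destruct (bohr_upper_bound gamma k f a rho hgamma Hrho Hf Ha) as (A & HA & Hconv & Hb).
    split; [exact Hconv|]. eapply Rle_trans; [exact Hb|].
    apply (bohr_majorant_le_1 k rk); auto; lra.
  - intros rho Hrho.
    destruct (bohr_majorant_gt_1 k rk rho Hrk E Hrho) as (al & Hal & Hgt).
    exists (extremal gamma k al), (extremal_coef gamma k al).
    split; [now apply extremal_class_B|]. split; [now apply extremal_expansion|].
    destruct (extremal_bohr gamma k al rho hgamma Hal) as [Hconv Eq]; [lra|].
    split; [exact Hconv|]. now rewrite Eq.
Qed.
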